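(* Let $G\times M\to M$, $z\mapsto g\cdot z$, be a left action of a Lie group $G$ on a manifold $M$ with coordinates $z$, with matrix of infinitesimals $\Phi$, and let $\boldsymbol\xi=(\xi_1,\dots,\xi_r)$ be the coordinates on $\mathfrak g^*$. Then the action of the Lie group on $M\times\mathfrak g^*$ given by $$G\times(M\times\mathfrak g^* )\to M\times\mathfrak g^*,\qquad g\cdot(z,\boldsymbol\xi)=\left(g^{-1}\cdot z,\ \boldsymbol\xi\,\mathbf{Ad}(g)\right)$$ is canonical for the Poisson bracket $$\{F,H\}=\begin{pmatrix}\nabla_zF^T&\nabla_{\boldsymbol\xi}F^T\end{pmatrix}\begin{pmatrix}0&\Phi\\-\Phi^T&\Lambda(\mathfrak g^* )\end{pmatrix}\begin{pmatrix}\nabla_zH\\\nabla_{\boldsymbol\xi}H\end{pmatrix}$$ on $C^\infty(M\times\mathfrak g^*,\mathbb R)$.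
   Context: Let $G$ be a Lie group of dimension $r$, with Lie algebra $\mathfrak g=T_eG$ and bracket $[v,w]=\frac{d}{dt}|_{t=0}\mathrm{Ad}(\exp(tv))w$ (for matrix groups, $\mathrm{Ad}(g)v=gvg^{-1}$ and $[X,Y]=XY-YX$). A left action satisfies $h\cdot(g\cdot z)=(hg)\cdot z$. Everything is local: $M$ is taken to be an open subset of $\mathbb R^p$ with coordinates $z=(z^1,\dots,z^p)$. Fix a basis $v_1,\dots,v_r$ of $\mathfrak g$. The matrix of infinitesimals is the $p\times r$ matrix $\Phi(z)$ with $\Phi_{\ell k}(z)=\frac{d}{dt}|_{t=0}(\exp(tv_k)\cdot z)^\ell$. The coordinates on $\mathfrak g^*$ are $\xi_i(\theta)=\theta(v_i)$, written as a row vector $\boldsymbol\xi$. If $[v_i,v_j]=\sum_kc_{ij}^kv_k$, then $\Lambda(\mathfrak g^* )$ is the $r\times r$ matrix with entries $\sum_kc_{ij}^k\xi_k$. The matrix $\mathbf{Ad}(g)$ is the $r\times r$ matrix of the Adjoint map in the basis $(v_j)$: $\mathrm{Ad}(g)v_j=\sum_i\mathbf{Ad}(g)_{ij}v_i$. The action is canonical for the bracket if for every $g\in G$ the diffeomorphism $\psi_g:(z,\boldsymbol\xi)\mapsto(g^{-1}\cdot z,\boldsymbol\xi\,\mathbf{Ad}(g))$ preserves it, i.e. $\{F\circ\psi_g,H\circ\psi_g\}=\{F,H\}\circ\psi_g$ for all smooth $F,H$. *)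

(* Defs.v *)
From HB Require Import structures.
From mathcomp Require Import all_boot all_order all_algebra.
From mathcomp Require Import all_classical all_reals all_analysis.

Set Implicit Arguments.
Unset Strict Implicit.
Unset Printing Implicit Defensive.

Import Order.TTheory GRing.Theory Num.Theory.
Import numFieldNormedType.Exports.

Local Open Scope classical_set_scope.
Local Open Scope ring_scope.

Section Smooth.
Context {R : realType} {V W : normedModType R}.

(* For finite-dimensional [V], requiring all the maps [x |-> df_x(v)] to be
   C^k amounts to requiring the derivative [df] itself to be C^k. *)
Fixpoint C_on (k : nat) (U : set V) (f : V -> W) : Prop :=
  match k with
  | 0%N => forall x, U x -> {for x, continuous f}
  | k'.+1 => (forall x, U x -> differentiable f x) /\
             (forall v : V, C_on k' U (fun x => 'd f x v))
  end.

(* Meant for open [U]: the values of [f] outside [U] are then irrelevant. *)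
Definition smooth_on (U : set V) (f : V -> W) : Prop := forall k, C_on k U f.

End Smooth.

(* A chart of [T] modelled on [E]. [chart_map] only matters on [chart_dom], and
   [chart_inv] only on the image of [chart_dom]; both are total functions. *)
Record chart (T E : Type) := Chart {
  chart_dom : set T;
  chart_map :> T -> E;
  chart_inv : E -> T }.

Definition chart_cod (T E : Type) (c : chart T E) : set E :=
  c @` chart_dom c.

Section Atlas.
Context {R : realType} {T : topologicalType} {E : normedModType R}.

Definition is_chart (c : chart T E) : Prop :=
  [/\ open (chart_dom c), open (chart_cod c),
      {in chart_dom c, cancel c (chart_inv c)},
      forall x, chart_dom c x -> {for x, continuous c} &
      forall y, chart_cod c y -> {for y, continuous (chart_inv c)}].

Definition is_smooth_atlas (A : set (chart T E)) : Prop :=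
  [/\ forall c, A c -> is_chart c,
      forall x : T, exists2 c, A c & chart_dom c x &
      forall c d, A c -> A d ->
        smooth_on (c @` (chart_dom c `&` chart_dom d)) (d \o chart_inv c)].

End Atlas.

Definition prod_chart (T1 T2 E1 E2 : Type) (c : chart T1 E1) (d : chart T2 E2)
    : chart (T1 * T2) (E1 * E2) :=
  Chart (chart_dom c `*` chart_dom d)
        (fun x => (c x.1, d x.2))
        (fun y => (chart_inv c y.1, chart_inv d y.2)).

Definition prod_atlas (T1 T2 E1 E2 : Type)
    (A : set (chart T1 E1)) (B : set (chart T2 E2))
    : set (chart (T1 * T2) (E1 * E2)) :=
  [set prod_chart c d | c in A & d in B].

Definition std_atlas (E : Type) : set (chart E E) :=
  [set Chart [set: E] id id].
Arguments std_atlas E : clear implicits.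

(* Smoothness of [f] on the open subset [U] of [T], read in charts. *)
Definition smooth_map {R : realType} {T T' : topologicalType}
    {E E' : normedModType R} (A : set (chart T E)) (A' : set (chart T' E'))
    (U : set T) (f : T -> T') : Prop :=
  (forall x, U x -> {for x, continuous f}) /\
  (forall c d, A c -> A' d ->
     smooth_on (c @` (U `&` chart_dom c `&` f @^-1` chart_dom d))
               (d \o f \o chart_inv c)).

HB.mixin Record isLieGroup (R : realType) (r : nat) G
    of Group G & Topological G := {
  lie_atlas : set (chart G 'rV[R]_r);
  lie_hausdorff : hausdorff_space G;
  lie_second_countable : @second_countable G;
  lie_atlasP : is_smooth_atlas lie_atlas;
  lie_mul_smooth : smooth_map (prod_atlas lie_atlas lie_atlas) lie_atlas setT
    (fun x : G * G => (x.1 * x.2)%g);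
  lie_inv_smooth : smooth_map lie_atlas lie_atlas setT
    (fun x : G => (x^-1)%g) }.

#[short(type="lieGroupType")]
HB.structure Definition LieGroup (R : realType) (r : nat) :=
  {G of isLieGroup R r G & Group G & Topological G}.

Arguments lie_atlas {R r} G : rename.

(* The tangent space T_eG is identified with R^r through a chart [c] around the
   unit: a tangent vector is its row of components in [c]. *)
Section LieAlgebra.
Context {R : realType} {r : nat} {G : lieGroupType R r}.
Variable c : chart G 'rV[R]_r.

Definition is_unit_chart : Prop := lie_atlas G c /\ chart_dom c 1%g.

Definition Ad (g : G) (w : 'rV[R]_r) : 'rV[R]_r :=
  'd (fun x : 'rV[R]_r => c (g * chart_inv c x * g^-1)%g) (c 1%g) w.

Definition one_param_subgroup (v : 'rV[R]_r) (gam : R -> G) : Prop :=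
  [/\ forall s t : R, gam (s + t) = (gam s * gam t)%g,
      smooth_map (std_atlas R) (lie_atlas G) setT gam &
      is_derive (0 : R) (1 : R) (c \o gam) v].

(* [exp v] is the value at time 1 of the one-parameter subgroup with velocity
   [v]; the default value 1 is never used, as that subgroup exists. *)
Definition lie_exp (v : 'rV[R]_r) : G :=
  xget 1%g [set gam 1 | gam in one_param_subgroup v].

Definition lie_bracket (v w : 'rV[R]_r) : 'rV[R]_r :=
  derive1 (fun t : R => Ad (lie_exp (t *: v)) w) 0.

Variable b : r.-tuple 'rV[R]_r.

Definition Ad_mx (g : G) : 'M[R]_r :=
  \matrix_(i < r, j < r) coord b i (Ad g b`_j).

Definition struct_const (i j k : 'I_r) : R := coord b k (lie_bracket b`_i b`_j).

Definition Lambda (xi : 'rV[R]_r) : 'M[R]_r :=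
  \matrix_(i < r, j < r) \sum_(k < r) struct_const i j k * xi 0 k.

End LieAlgebra.

Section Action.
Context {R : realType} {r p : nat} {G : lieGroupType R r}.

Definition is_smooth_left_action (M : set 'rV[R]_p)
    (act : G -> 'rV[R]_p -> 'rV[R]_p) : Prop :=
  [/\ forall g z, M z -> M (act g z),
      forall z, M z -> act 1%g z = z,
      forall h g z, M z -> act h (act g z) = act (h * g)%g z &
      smooth_map (prod_atlas (lie_atlas G) (std_atlas 'rV[R]_p))
        (std_atlas 'rV[R]_p) ([set: G] `*` M)
        (fun x : G * 'rV[R]_p => act x.1 x.2)].

Variables (c : chart G 'rV[R]_r) (b : r.-tuple 'rV[R]_r).
Variable act : G -> 'rV[R]_p -> 'rV[R]_p.

Definition Phi (z : 'rV[R]_p) : 'M[R]_(p, r) :=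
  \matrix_(l < p, k < r) derive1 (fun t : R => act (lie_exp c (t *: b`_k)) z 0 l) 0.

(* A point of M x g^* is a pair (z, xi), xi being the row of coordinates
   xi_i = theta(v_i) of the covector theta. *)
Definition psi (g : G) (x : 'rV[R]_p * 'rV[R]_r) : 'rV[R]_p * 'rV[R]_r :=
  (act g^-1%g x.1, x.2 *m Ad_mx c b g).

Implicit Types F H : 'rV[R]_p * 'rV[R]_r -> R.

Definition grad_z F x : 'cV[R]_p :=
  \col_(l < p) 'D_((delta_mx 0 l, 0) : 'rV[R]_p * 'rV[R]_r) F x.

Definition grad_xi F x : 'cV[R]_r :=
  \col_(k < r) 'D_((0, delta_mx 0 k) : 'rV[R]_p * 'rV[R]_r) F x.

Definition poisson F H (x : 'rV[R]_p * 'rV[R]_r) : R :=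
  (row_mx (grad_z F x)^T (grad_xi F x)^T *m
   block_mx 0 (Phi x.1) (- (Phi x.1)^T) (Lambda c b x.2) *m
   col_mx (grad_z H x) (grad_xi H x)) 0 0.

End Action.

(* [br] preserved by every [psi g], as functions on [D] *)
Definition is_canonical {R : realType} {G : Type} {V : normedModType R}
    (D : set V) (br : (V -> R) -> (V -> R) -> V -> R) (psi : G -> V -> V)
    : Prop :=
  forall (g : G) (F H : V -> R), smooth_on D F -> smooth_on D H ->
  forall x, D x -> br (F \o psi g) (H \o psi g) x = br F H (psi g x).

(* Main.v *)
(* Write B = Ad(g) and let A be the Jacobian of g^-1 at z.  By the chain rule the
   gradients of F o psi_g are A^T grad_z F and B grad_xi F, so the theorem amounts
   to Phi(g^-1 z) = A Phi(z) B and Lambda(xi B) = B^T Lambda(xi) B.  The first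
   identity is the derivative at y = 1 of  y (g^-1 z) = g^-1 ((g y g^-1) z);  the
   second says that Ad(g) preserves the bracket, and is the derivative at y = 1 of
   Ad(g) Ad(y) = Ad(g y g^-1) Ad(g).

   Both Phi and the bracket are defined through exp, so exp has to be shown to have
   the expected velocity, i.e. one-parameter subgroups must exist and be unique.
   Existence is proved without differential equations: if q_n is the group element
   with coordinates v / 2^n, then q_n ^ floor(2^n t) converges, because in a chart
   the product is the sum up to a term which is O(|x| |y|), with a matching
   Lipschitz estimate.  The limit is a homomorphism t |-> gam t with
   |gam t - t v| = O(t^2), which suffices for smoothness. *)

Require Import Defs.
From HB Require Import structures.
From mathcomp Require Import all_boot all_order all_algebra.
From mathcomp Require Import all_classical all_reals all_analysis.
From mathcomp Require Import ring lra.

Import Order.TTheory GRing.Theory Num.Theory.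
Import numFieldNormedType.Exports.

Local Open Scope classical_set_scope.
Local Open Scope ring_scope.

Set Implicit Arguments.
Unset Strict Implicit.
Unset Printing Implicit Defensive.

(** * Calculus of C^k maps *)

(** [Phi] and the bracket see exp only along lines t v. So the one thing to prove about it is that
    f(exp(t v)) has derivative df(v) at t = 0 whenever f is differentiable in the chart at 1.
    [lie_exp] selects an arbitrary subgroup of velocity v, so uniqueness is what gives it a
    computable value on the whole line. The bilinear size |x| |y| of the remainder of the product is
    what makes the powers converge. The elements q_n and q_(n+1)^2 differ by O(4^-n), and raising
    them to a power of at most 2^n multiplies this by O(2^n), leaving a summable O(2^-n). A
    remainder that is merely o(|x| + |y|) would not survive this. The bilinear bound comes from the
    mean value theorem, applied once in each factor to the mixed difference of the product, which is
    C^2 in the chart. Setting one or both of the comparison points to 1 then yields the Lipschitz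
    estimates and the comparison with the sum. *)

Section DifferentialLocality.
Context {R : realType} {V W : normedModType R}.
Implicit Types f g : V -> W.

(** A quadratic error is o(|h|) and vanishes at [x]. With [K] = 0 this is the locality of the
    differential; with [K] > 0 it differentiates a one-parameter subgroup at 0. *)
Lemma is_diff_near_sqr f g (x : V) (df : V -> W) (K : R) :
  (\forall y \near x, `|f y - g y| <= K * `|y - x| ^+ 2) ->
  is_diff x g df -> is_diff x f df.
Proof.
move=> fg dg.
have dgc : continuous ('d g x) by apply: diff_continuous.
have fgx : f x = g x.
  apply/eqP; rewrite -subr_eq0 -normr_le0.
  by apply: le_trans (nbhs_singleton fg) _; rewrite subrr normr0 expr0n mulr0.
have E : f \o shift x = cst (f x) + 'd g x +o_ 0 id.
  apply/eqaddoP => _/posnumP[eps].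
  have /eqaddoP /(_ (eps%:num / 2) [gt0 of eps%:num / 2]) :=
    diff_locally (@ex_diff _ _ _ _ _ _ _ dg).
  have fgx0 : \forall h \near (0 : V), `|f (h + x) - g (h + x)| <= K * `|h| ^+ 2.
    move: fg; rewrite (near_shift 0 x) subr0; apply: filterS => h /=.
    by rewrite addrK.
  apply: filter_app; apply: filter_app fgx0; near=> h => fgh gh.
  rewrite /= !fctE /= fgx; rewrite /= !fctE /= in gh.
  have -> : f (h + x) - (g x + 'd g x h) =
      (f (h + x) - g (h + x)) + (g (h + x) - (g x + 'd g x h)).
    by rewrite addrA subrK.
  apply: le_trans (ler_normD _ _) _.
  rewrite [eps%:num in leRHS]splitr mulrDl; apply: lerD => //.
  apply: le_trans fgh _; rewrite expr2 mulrA ler_wpM2r //.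
  have K1 : 0 < `|K| + 1 by rewrite ltr_pwDr.
  apply: (@le_trans _ _ ((`|K| + 1) * `|h|)).
    by rewrite ler_wpM2r // (le_trans (ler_norm K)) // lerDl.
  rewrite -ler_pdivlMl //; apply: ltW; near: h; apply: nbhs0_lt.
have := diff_unique dgc E => dfE.
apply: DiffDef; last by rewrite dfE diff_val.
by apply/diff_locallyP; rewrite dfE.
Unshelve. all: by end_near. Qed.

Lemma near_eq_is_diff f g (x : V) (df : V -> W) :
  (\forall y \near x, f y = g y) -> is_diff x g df -> is_diff x f df.
Proof.
move=> fg; apply: (@is_diff_near_sqr _ _ _ _ 0); apply: filterS fg => y ->.
by rewrite subrr normr0 mul0r.
Qed.

Lemma near_eq_differentiable f g (x : V) :
  (\forall y \near x, f y = g y) -> differentiable g x -> differentiable f x.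
Proof. by move=> fg /differentiableP /(near_eq_is_diff fg)[]. Qed.

Lemma near_eq_diff f g (x : V) :
  (\forall y \near x, f y = g y) -> differentiable g x ->
  'd f x = 'd g x :> (V -> W).
Proof. by move=> fg /differentiableP /(near_eq_is_diff fg)[]. Qed.

End DifferentialLocality.

Section DiffProjections.
Context {R : realType} {V W : normedModType R}.

Lemma is_diff_fst (x : V * W) : is_diff x fst fst.
Proof.
apply: DiffDef; first exact: (@linear_differentiable _ _ _ fst _ (fun x => cvg_fst)).
exact: (@diff_lin _ _ _ fst _ (fun x => cvg_fst)).
Qed.

Lemma is_diff_snd (x : V * W) : is_diff x snd snd.
Proof.
apply: DiffDef; first exact: (@linear_differentiable _ _ _ snd _ (fun x => cvg_snd)).
exact: (@diff_lin _ _ _ snd _ (fun x => cvg_snd)).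
Qed.

End DiffProjections.

Section DiffScale.
Context {R : realType} {V W : normedModType R}.

Lemma scale_is_bilinear : bilinear_for
  (GRing.Scale.Law.clone _ _ *:%R _) (GRing.Scale.Law.clone _ _ *:%R _)
  (fun (a : R) (w : W) => a *: w).
Proof.
split=> [u'|u] a x y /=.
- by rewrite scalerDl scalerA.
- by rewrite scalerDr !scalerA mulrC.
Qed.

Lemma is_diff_scale (a : V -> R) (f : V -> W) da df (x : V) :
  is_diff x a da -> is_diff x f df ->
  is_diff x (fun y => a y *: f y) (fun v => a x *: df v + da v *: f x).
Proof.
move=> Da Df.
pose bM := bilinear_isBilinear.Build R R W W _ _ _ scale_is_bilinear.
pose b : {bilinear R -> W -> W} := HB.pack (fun (a : R) (w : W) => a *: w) bM.
have bc : continuous (fun p => b p.1 p.2) by move=> p; apply: scale_continuous.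
have db := @differentiable_bilin _ R W W b (a x, f x) bc.
have Dab : is_diff x (fun y => (a y, f y)) (fun v => (da v, df v)).
  exact: is_diff_pair.
have -> : (fun y => a y *: f y) = (fun p => b p.1 p.2) \o (fun y => (a y, f y)).
  by [].
apply: DiffDef; first exact: differentiable_comp.
rewrite diff_comp // diff_bilin // (@diff_val _ _ _ _ _ _ _ Dab).
by [].
Qed.

End DiffScale.

Section COn.
Context {R : realType}.
Implicit Types V W : normedModType R.

Lemma C_on_sub {V W} k (U U' : set V) (f : V -> W) :
  U' `<=` U -> C_on k U f -> C_on k U' f.
Proof.
move=> sU; elim: k f => [|k IH] f /=; first by move=> + x /sU; apply.
by move=> [df cf]; split=> [x /sU /df//|v]; exact/IH.
Qed.

Lemma C_onW {V W} k (U : set V) (f : V -> W) : C_on k.+1 U f -> C_on k U f.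
Proof.
elim: k f => [|k IH] f [df cf].
  by move=> x /df; exact: differentiable_continuous.
by split=> // v; exact/IH/cf.
Qed.

Lemma C_on_continuous {V W} k (U : set V) (f : V -> W) x :
  C_on k U f -> U x -> {for x, continuous f}.
Proof. by elim: k => [|k IH]; [move=> + Ux; exact|move=> /C_onW]. Qed.

(** As [U] is open, [f] and [g] agree near each of its points, hence so do their differentials, and
    the induction can proceed. *)
Lemma C_on_eq {V W} k (U : set V) (f g : V -> W) :
  open U -> (forall x, U x -> f x = g x) -> C_on k U f -> C_on k U g.
Proof.
move=> oU; elim: k f g => [|k IH] f g fg.
  move=> cf x Ux; change (g @ x --> g x); rewrite -(fg x Ux).
  apply: cvg_trans (cf x Ux); apply: near_eq_cvg.
  by near do apply: fg; exact: open_nbhs_nbhs.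
have nfg x : U x -> \forall y \near x, g y = f y.
  by move=> Ux; near do apply/esym/fg; exact: open_nbhs_nbhs.
move=> [df cf]; split=> [x Ux|v].
  exact: near_eq_differentiable (nfg x Ux) (df x Ux).
apply: IH (cf v) => x Ux.
by rewrite (near_eq_diff (nfg x Ux) (df x Ux)).
Unshelve. all: by end_near. Qed.

Lemma C_on_cst {V W} k (U : set V) (w : W) : C_on k U (cst w).
Proof.
elim: k w => [|k IH] w /=; first by move=> x _; exact: cst_continuous.
split=> [x _|v]; first exact: differentiable_cst.
rewrite (_ : (fun _ => _) = cst 0); first exact: IH.
by apply/funext => x; rewrite diff_cst.
Qed.

Lemma C_onD {V W} k (U : set V) (f g : V -> W) : open U ->
  C_on k U f -> C_on k U g -> C_on k U (fun x => f x + g x).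
Proof.
move=> oU; elim: k f g => [|k IH] f g.
  by move=> cf cg x Ux; apply: continuousD; [exact: cf|exact: cg].
move=> [df cf] [dg cg]; split=> [x Ux|v].
  by apply: differentiableD; [exact: df|exact: dg].
apply: C_on_eq (IH _ _ (cf v) (cg v)) => // x Ux.
by rewrite diffD //; [exact: df|exact: dg].
Qed.

Lemma C_on_sum {V W} k (U : set V) (I : finType) (f : I -> V -> W) : open U ->
  (forall i, C_on k U (f i)) -> C_on k U (fun x => \sum_i f i x).
Proof.
move=> oU cf.
elim: (index_enum I) => [|i s IH].
  rewrite (_ : (fun _ => _) = cst 0); first exact: C_on_cst.
  by apply/funext => x; rewrite big_nil.
rewrite (_ : (fun _ => _) = (fun x => f i x + \sum_(i <- s) f i x)).
  exact: C_onD.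
by apply/funext => x; rewrite big_cons.
Qed.

Lemma C_onZ {V W} k (U : set V) (a : V -> R) (f : V -> W) : open U ->
  C_on k U a -> C_on k U f -> C_on k U (fun x => a x *: f x).
Proof.
move=> oU; elim: k a f => [|k IH] a f.
  by move=> ca cf x Ux; apply: continuousZ; [exact: ca|exact: cf].
move=> Ca Cf; have [da ca] := Ca; have [df cf] := Cf.
have D x : U x -> is_diff x (fun y => a y *: f y)
    (fun v => a x *: 'd f x v + 'd a x v *: f x).
  by move=> Ux; apply: is_diff_scale; apply: differentiableP; [exact: da|exact: df].
split=> [x /D[]//|v].
apply: C_on_eq (C_onD oU (IH _ _ (C_onW Ca) (cf v)) (IH _ _ (ca v) (C_onW Cf)))
  => // x Ux.
by rewrite (@diff_val _ _ _ _ _ _ _ (D x Ux)).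
Qed.

Lemma C_on_linear {V W W' : normedModType R} k (U : set V) (L : {linear W -> W'})
    (f : V -> W) : open U -> continuous L -> C_on k U f -> C_on k U (L \o f).
Proof.
move=> oU cL; elim: k f => [|k IH] f.
  move=> cf x Ux; apply: continuous_comp; [exact: cf|exact: cL].
move=> [df cf]; split=> [x Ux|v].
  by apply: differentiable_comp; [exact: df|exact: linear_differentiable].
apply: C_on_eq (IH _ (cf v)) => // x Ux.
rewrite diff_comp; [|exact: df|exact: linear_differentiable].
by rewrite /= diff_lin.
Qed.

(** The differential of [h] is the same at all points, so the derivative of [f \o h] along v is the
    derivative of [f] along the fixed vector [dh v], composed with [h]: the induction closes without
    a frame. *)
Lemma C_on_affine {V V' W : normedModType R} k (U : set V) (U' : set V')
    (h : V -> V') (dh : V -> V') (f : V' -> W) :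
  open U -> (forall x, is_diff x h dh) -> (forall x, U x -> U' (h x)) ->
  C_on k U' f -> C_on k U (f \o h).
Proof.
move=> oU Dh hU; elim: k f => [|k IH] f.
  move=> cf x Ux; apply: continuous_comp; last exact/cf/hU.
  by apply: differentiable_continuous; apply: ex_diff.
move=> [df cf]; split=> [x Ux|v].
  by apply: differentiable_comp; [apply: ex_diff|exact/df/hU].
apply: C_on_eq (IH _ (cf (dh v))) => // x Ux.
rewrite diff_comp; [|by apply: ex_diff|exact/df/hU].
by rewrite /= (@diff_val _ _ _ _ _ _ _ (Dh x)).
Qed.

Lemma C_on_pair {V W W' : normedModType R} k (U : set V) (f : V -> W)
    (g : V -> W') : open U ->
  C_on k U f -> C_on k U g -> C_on k U (fun x => (f x, g x)).
Proof.
move=> oU; elim: k f g => [|k IH] f g.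
  by move=> cf cg x Ux; apply: cvg_pair; [exact: cf|exact: cg].
move=> [df cf] [dg cg]; split=> [x Ux|v].
  by apply: differentiable_pair; [exact: df|exact: dg].
apply: C_on_eq (IH _ _ (cf v) (cg v)) => // x Ux.
by rewrite diff_pair //; [exact: df|exact: dg].
Qed.

(* A way to say that [V] is finite-dimensional. *)
Definition has_frame (V : normedModType R) : Prop :=
  exists (I : finType) (e : I -> V) (pi : I -> {linear V -> R}),
    (forall i, continuous (pi i)) /\ forall x, x = \sum_i pi i x *: e i.

Lemma has_frame_rV n : has_frame 'rV[R]_n.
Proof.
have lin i : linear (fun x : 'rV[R]_n => x 0 i : R).
  by move=> a x y; rewrite !mxE.
pose lM i := GRing.isLinear.Build _ _ _ _ _ (lin i).
pose l i : {linear 'rV[R]_n -> R} := HB.pack (fun x : 'rV[R]_n => x 0 i : R) (lM i).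
exists 'I_n, (fun i => delta_mx 0 i), l; split=> [i|x].
  exact: coord_continuous.
by rewrite {1}[x]row_sum_delta.
Qed.

Lemma sum_scale_pairl V W (I : finType) (a : I -> R) (e : I -> V) :
  \sum_i a i *: (e i, 0 : W) = (\sum_i a i *: e i, 0).
Proof.
elim/big_rec2: _ => // i u [v1 v2] _ [-> ->].
by congr pair; rewrite /= scaler0 add0r.
Qed.

Lemma sum_scale_pairr V W (I : finType) (a : I -> R) (e : I -> W) :
  \sum_i a i *: (0 : V, e i) = (0, \sum_i a i *: e i).
Proof.
elim/big_rec2: _ => // i u [v1 v2] _ [-> ->].
by congr pair; rewrite /= scaler0 add0r.
Qed.

Lemma has_frame_pair V W : has_frame V -> has_frame W -> has_frame (V * W)%type.
Proof.
move=> [I [e [pi [cpi piE]]]] [J [f [rho [crho rhoE]]]].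
have lin1 i : linear (fun x : V * W => pi i x.1) by move=> a x y; rewrite linearP.
have lin2 j : linear (fun x : V * W => rho j x.2) by move=> a x y; rewrite linearP.
pose M1 i := GRing.isLinear.Build _ _ _ _ _ (lin1 i).
pose M2 i := GRing.isLinear.Build _ _ _ _ _ (lin2 i).
pose l1 i : {linear (V * W)%type -> R} := HB.pack (fun x : V * W => pi i x.1) (M1 i).
pose l2 i : {linear (V * W)%type -> R} := HB.pack (fun x : V * W => rho i x.2) (M2 i).
pose l (s : I + J) := match s with inl i => l1 i | inr j => l2 j end.
pose b (s : I + J) : V * W :=
  match s with inl i => (e i, 0) | inr j => (0, f j) end.
exists (I + J)%type, b, l; split=> [[i|j]|[x y]].
- move=> x; apply: (@continuous_comp _ _ _ fst (pi i)); [exact: cvg_fst|exact: cpi].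
- move=> x; apply: (@continuous_comp _ _ _ snd (rho j)); [exact: cvg_snd|exact: crho].
rewrite big_sumType /= {1}[x]piE {1}[y]rhoE.
rewrite sum_scale_pairl sum_scale_pairr.
by congr pair; rewrite /= ?addr0 ?add0r.
Qed.

(** [C_on] controls the derivatives of [g] along fixed vectors only, whereas the chain rule needs
    them along ['d f x v], which moves with x. A frame writes this vector as a sum of C^k
    coefficients times fixed vectors. *)
Lemma C_on_comp {V V' W : normedModType R} k (U : set V) (U' : set V')
    (f : V -> V') (g : V' -> W) :
  has_frame V' -> open U -> (forall x, U x -> U' (f x)) ->
  C_on k U f -> C_on k U' g -> C_on k U (g \o f).
Proof.
move=> [I [e [pi [cpi piE]]]] oU fU; elim: k g => [|k IH] g.
  by move=> cf cg x Ux; apply: continuous_comp; [exact: cf|exact/cg/fU].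
move=> Cf Cg; have [df cf] := Cf; have [dg cg] := Cg; split=> [x Ux|v].
  by apply: differentiable_comp; [exact: df|exact/dg/fU].
have CS : C_on k U (fun x => \sum_i pi i ('d f x v) *: 'd g (f x) (e i)).
  apply: C_on_sum => // i; apply: C_onZ => //; first exact: C_on_linear (cf v).
  by apply: (IH _ _ (cg (e i))); exact: C_onW.
apply: C_on_eq CS => // x Ux.
rewrite [in RHS]diff_comp; [|exact: df|exact/dg/fU].
rewrite /= [in RHS](piE ('d f x v)) linear_sum; apply: eq_bigr => i _.
by rewrite linearZ.
Qed.

End COn.

(** * Mixed second differences of C^2 maps *)

Section MixedDifference.
Context {R : realType}.
Implicit Types V : normedModType R.

Lemma mean_value_segment V (f : V -> R) (x u : V) :
  (forall s : R, 0 <= s <= 1 -> differentiable f (x + s *: u)) ->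
  exists2 s, 0 <= s <= 1 & f (x + u) - f x = 'd f (x + s *: u) u.
Proof.
move=> df; pose phi (s : R) := f (x + s *: u).
have Dl (s : R) : is_diff s (fun s : R => x + s *: u) (fun h => h *: u).
  have D1 := is_diff_scalel s u.
  have D2 : is_diff s (cst x) 0 by exact: is_diff_cst.
  refine (is_diff_eq (is_diffD D2 D1) _).
  by apply/funext => h; rewrite !fctE add0r.
have Dphi (s : R) : 0 <= s <= 1 -> is_diff s phi (fun h => 'd f (x + s *: u) (h *: u)).
  by move=> s01; apply: is_diff_comp; exact/differentiableP/df.
have dphi (t : R) : t \in `]0, 1[%R -> is_derive t 1 phi ('d f (x + t *: u) u).
  move=> /[!in_itv]/= /andP[t0 t1].
  have t01 : 0 <= t <= 1 by rewrite !ltW.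
  have [p1 p2] := Dphi t t01.
  apply: DeriveDef; first exact: diff_derivable.
  by rewrite deriveE // p2 scale1r.
have cphi : {within `[0, 1], continuous phi}.
  apply: derivable_within_continuous => t /[!in_itv]/= t01.
  by have [p1 _] := Dphi t t01; exact: diff_derivable.
have [s s01 E] := MVT_segment ler01 dphi cphi.
exists s; first by rewrite in_itv/= in s01.
by move: E; rewrite subr0 mulr1 /phi scale1r scale0r addr0.
Qed.

Lemma segment_in_ball V (x0 x x' : V) (d s : R) : 0 <= s <= 1 ->
  `|x - x0| < d -> `|x' - x0| < d -> `|x' + s *: (x - x') - x0| < d.
Proof.
move=> /andP[s0 s1] xd x'd.
have -> : x' + s *: (x - x') - x0 = (1 - s) *: (x' - x0) + s *: (x - x0).
  rewrite scalerBl scale1r -[in RHS]addrA [X in _ = _ + X]addrC -scalerBr.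
  by rewrite opprB addrA subrK addrAC.
apply: le_lt_trans (ler_normD _ _) _; rewrite !normrZ.
rewrite [`|s|]ger0_norm // [`|1 - s|]ger0_norm ?subr_ge0 //.
(* Strictness is taken from the second summand, whose weight vanishes at [s] = 0. *)
have [->|sn0] := eqVneq s 0; first by rewrite subr0 mul1r mul0r addr0.
have sp : 0 < s by rewrite lt0r sn0.
have: (1 - s) * `|x' - x0| <= (1 - s) * d by rewrite ler_wpM2l ?subr_ge0 // ltW.
have: s * `|x - x0| < s * d by rewrite ltr_pM2l.
lra.
Qed.

(** The mean value theorem in the first variable, for f(., y) - f(., y'), leaves a difference of
    first partial derivatives; applied again in the second variable, it leaves mixed second
    derivatives, which are bounded near the base point. Stating the bound for all small [d] lets
    finitely many components share one radius. *)
Lemma mixed_difference_scalar V V' (f : V * V' -> R) (O : set (V * V')) x0 y0 :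
  has_frame V -> has_frame V' -> open O -> O (x0, y0) -> C_on 2 O f ->
  exists2 C : R, 0 <= C & \forall d \near 0^'+, forall x x' y y',
    `|x - x0| < d -> `|x' - x0| < d -> `|y - y0| < d -> `|y' - y0| < d ->
    `|f (x, y) - f (x', y) - f (x, y') + f (x', y')| <= C * `|x - x'| * `|y - y'|.
Proof.
move=> [I [e [pi [cpi piE]]]] [J [b [rho [crho rhoE]]]] oO Oz0 [df cf].
pose g i z := 'd f z (e i, 0).
have dg i : forall z, O z -> differentiable (g i) z by have [] := cf (e i, 0).
(* By continuity the mixed derivative stays within 1 of its value at the base point. *)
pose B i j := `|'d (g i) (x0, y0) (0, b j)| + 1.
have nB : \forall z \near (x0, y0), O z /\
    forall i j, `|'d (g i) z (0, b j)| <= B i j.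
  near=> z; split; first by near: z; exact: open_nbhs_nbhs.
  near: z; apply: filter_forall => i; apply: filter_forall => j.
  have [_ /(_ (0, b j))/(_ _ Oz0)] := cf (e i, 0).
  rewrite -/(g i) => ch.
  have /cvgrPdist_lt cn : `|'d (g i) z (0, b j)| @[z --> (x0, y0)] -->
    `|'d (g i) (x0, y0) (0, b j)| by exact: cvg_norm.
  apply: filterS (cn 1 ltr01) => z' /= zB.
  by rewrite /B -lerBlDl ltW //; move: zB; rewrite distrC => /ltr_normlW.
have [K K0 piK] : exists2 K : I -> R, forall i, 0 <= K i &
    forall i u, `|pi i u| <= K i * `|u|.
  have /choice[K KP] : forall i, exists k, 0 <= k /\ forall u, `|pi i u| <= k * `|u|.
    by move=> i; have [k k0 kP] := linear_lipschitz (cpi i); exists k; split => //; exact: ltW.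
  by exists K => i; have [] := KP i.
have [L L0 rhoL] : exists2 K : J -> R, forall i, 0 <= K i &
    forall i u, `|rho i u| <= K i * `|u|.
  have /choice[K' KP] : forall i, exists k, 0 <= k /\ forall u, `|rho i u| <= k * `|u|.
    by move=> i; have [k k0 kP] := linear_lipschitz (crho i); exists k; split => //; exact: ltW.
  by exists K' => i; have [] := KP i.
have B0 i j : 0 <= B i j by rewrite addr_ge0.
(* [K] and [L] bound the frame coordinates of x - x' and of y - y' by the norms of these vectors. *)
exists (\sum_i K i * \sum_j L j * B i j).
  apply: sumr_ge0 => i _; apply: mulr_ge0 => //; apply: sumr_ge0 => j _.
  exact: mulr_ge0.
have /nbhs_ballP[e0 /= e00 ballB] := nB.
near=> d => x x' y y' xd x'd yd y'd.
have de0 : d <= e0 by near: d; exact: nbhs_right_le.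
have box a b' : `|a - x0| < d -> `|b' - y0| < d -> O (a, b') /\
    forall i j, `|'d (g i) (a, b') (0, b j)| <= B i j.
  move=> ad bd; apply: (ballB (a, b')); split; rewrite -ball_normE /= distrC.
    exact: lt_le_trans de0.
  exact: lt_le_trans de0.
have dx a b' : `|a - x0| < d -> `|b' - y0| < d ->
    is_diff a (fun a => f (a, b')) (fun u => 'd f (a, b') (u, 0)).
  move=> ad bd; have [Oab _] := box _ _ ad bd.
  have Dp : is_diff a (fun a => (a, b')) (fun u => (u, 0)).
    by apply: is_diff_pair; exact: is_diff_cst.
  exact: (@is_diff_comp _ _ _ _ _ _ f _ a Dp (differentiableP (df _ Oab))).
have dy i a b' : `|a - x0| < d -> `|b' - y0| < d ->
    is_diff b' (fun b' => g i (a, b')) (fun u => 'd (g i) (a, b') (0, u)).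
  move=> ad bd; have [Oab _] := box _ _ ad bd.
  have Dp : is_diff b' (fun b' => (a, b')) (fun u => (0, u)).
    by apply: is_diff_pair; exact: is_diff_cst.
  exact: (@is_diff_comp _ _ _ _ _ _ (g i) _ b' Dp (differentiableP (dg i _ Oab))).
have [s s01 Es] : exists2 s, 0 <= s <= 1 &
    f (x, y) - f (x', y) - f (x, y') + f (x', y') =
    'd f (x' + s *: (x - x'), y) (x - x', 0) - 'd f (x' + s *: (x - x'), y') (x - x', 0).
  have DD a : `|a - x0| < d -> is_diff a (fun a => f (a, y) - f (a, y'))
      (fun u => 'd f (a, y) (u, 0) - 'd f (a, y') (u, 0)).
    by move=> ad; apply: is_diffB; exact: dx.
  have [s s01] := @mean_value_segment _ (fun a => f (a, y) - f (a, y')) x' (x - x')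
    (fun s s01 => @ex_diff _ _ _ _ _ _ _ (DD _ (segment_in_ball s01 xd x'd))).
  rewrite (@diff_val _ _ _ _ _ _ _ (DD _ (segment_in_ball s01 xd x'd))).
  rewrite [x' + _]addrC subrK => E; exists s => //; rewrite -E.
  by move: (f (x, y)) (f (x', y)) (f (x, y')) (f (x', y')) => p q r t; ring.
rewrite Es; set a := x' + _.
have ad : `|a - x0| < d by exact: segment_in_ball.
have fE b' : 'd f (a, b') (x - x', 0) = \sum_i pi i (x - x') * g i (a, b').
  have -> : (x - x', 0 : V') = \sum_i pi i (x - x') *: (e i, 0).
    by rewrite sum_scale_pairl -piE.
  by rewrite linear_sum; apply: eq_bigr => i _; rewrite linearZ.
rewrite !fE -sumrB -mulrA mulr_suml; apply: le_trans (ler_norm_sum _ _ _) _.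
apply: ler_sum => i _; rewrite -mulrBr normrM.
have -> : K i * (\sum_j L j * B i j) * (`|x - x'| * `|y - y'|) =
  (K i * `|x - x'|) * ((\sum_j L j * B i j) * `|y - y'|) by ring.
apply: ler_pM => //.
have [t t01] := @mean_value_segment _ (fun b' => g i (a, b')) y' (y - y')
    (fun t t01 => @ex_diff _ _ _ _ _ _ _ (dy i _ _ ad (segment_in_ball t01 yd y'd))).
have y'd' := segment_in_ball t01 yd y'd.
rewrite [y' + (y - y')]addrC subrK => ->.
rewrite (@diff_val _ _ _ _ _ _ _ (dy i _ _ ad y'd')).
set b' := y' + _.
have -> : (0 : V, y - y') = \sum_j rho j (y - y') *: (0, b j).
  by rewrite sum_scale_pairr -rhoE.
rewrite linear_sum mulr_suml; apply: le_trans (ler_norm_sum _ _ _) _.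
apply: ler_sum => j _; rewrite linearZ normrM mulrAC.
have [_ Bb] := box _ _ ad y'd'.
by apply: ler_pM => //; exact: Bb.
Unshelve. all: by end_near. Qed.

Lemma normr_rV_le n (w : 'rV[R]_n) (C : R) : 0 <= C ->
  (forall i, `|w 0 i| <= C) -> `|w| <= C.
Proof.
move=> C0 wC; rewrite [leLHS]/Num.norm /= mx_normrE; apply/bigmax_leP; split => // -[i j] _ /=.
by rewrite ord1.
Qed.

Lemma mixed_difference V V' n (f : V * V' -> 'rV[R]_n) (O : set (V * V')) x0 y0 :
  has_frame V -> has_frame V' -> open O -> O (x0, y0) -> C_on 2 O f ->
  exists2 C : R, 0 <= C & exists2 d : R, 0 < d & forall x x' y y',
    `|x - x0| < d -> `|x' - x0| < d -> `|y - y0| < d -> `|y' - y0| < d ->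
    `|f (x, y) - f (x', y) - f (x, y') + f (x', y')| <= C * `|x - x'| * `|y - y'|.
Proof.
move=> hV hV' oO Oz0 Cf.
have lin i : linear (fun x : 'rV[R]_n => x 0 i : R).
  by move=> a x y; rewrite !mxE.
pose lM i := GRing.isLinear.Build _ _ _ _ _ (lin i).
pose l i : {linear 'rV[R]_n -> R} := HB.pack (fun x : 'rV[R]_n => x 0 i : R) (lM i).
have Cfi i : C_on 2 O (l i \o f).
  by apply: C_on_linear => //; exact: coord_continuous.
have /choice[C CP] : forall i, exists C : R, 0 <= C /\
    \forall d \near 0^'+, forall x x' y y',
    `|x - x0| < d -> `|x' - x0| < d -> `|y - y0| < d -> `|y' - y0| < d ->
    `|(l i \o f) (x, y) - (l i \o f) (x', y) - (l i \o f) (x, y') +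
      (l i \o f) (x', y')| <= C * `|x - x'| * `|y - y'|.
  by move=> i; have [C C0 CP] := mixed_difference_scalar hV hV' oO Oz0 (Cfi i); exists C.
exists (\sum_i C i); first by apply: sumr_ge0 => i _; have [] := CP i.
near (0 : R)^'+ => d.
exists d => // x x' y y' xd x'd yd y'd.
apply: normr_rV_le => [|i].
  by rewrite !mulr_ge0 //; apply: sumr_ge0 => i _; have [] := CP i.
have bnd : `|(l i \o f) (x, y) - (l i \o f) (x', y) - (l i \o f) (x, y') +
      (l i \o f) (x', y')| <= C i * `|x - x'| * `|y - y'|.
  move: x x' y y' xd x'd yd y'd; move: i; near: d.
  by apply: filter_forall => i; have [] := CP i.
rewrite !mxE; apply: le_trans bnd _.
rewrite -!mulrA ler_wpM2r ?mulr_ge0 // (bigD1 i) //= lerDl.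
by apply: sumr_ge0 => j _; have [] := CP j.
Unshelve. all: by end_near. Qed.

End MixedDifference.

(** * Charts of a Lie group *)

Section DifferentiabilityAlongCurves.
Context {R : realType}.

Lemma is_derive1_is_diff (W : normedModType R) (f : R -> W) (t : R) (w : W) :
  is_derive t 1 f w <-> is_diff t f ( *:%R^~ w).
Proof.
split=> [[df fE]|[df fE]].
  apply: DiffDef; first exact/derivable1_diffP.
  by rewrite deriv1E // derive1E fE.
apply: DeriveDef; first exact/derivable1_diffP.
by rewrite deriveE // fE scale1r.
Qed.

Lemma open_setI_preimage {T U : topologicalType} (A : set T) (B : set U)
    (f : T -> U) : open A -> (forall x, A x -> {for x, continuous f}) ->
  open B -> open (A `&` f @^-1` B).
Proof.
move=> oA cf oB; rewrite openE => x [Ax Bfx]; apply: filterI.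
  exact: open_nbhs_nbhs.
by apply: cf => //; exact: open_nbhs_nbhs.
Qed.

Lemma open_prod {T U : topologicalType} (A : set T) (B : set U) :
  open A -> open B -> open (A `*` B).
Proof.
move=> oA oB; rewrite openE => -[x y] [/= Ax By].
by exists (A, B) => //; split; exact: open_nbhs_nbhs.
Qed.

End DifferentiabilityAlongCurves.

Section LieGroupCharts.
Context {R : realType} {r : nat} {G : lieGroupType R r}.
Implicit Types (c d : chart G 'rV[R]_r) (g h : G) (x y : 'rV[R]_r).

Lemma lie_chartK c g : lie_atlas G c -> chart_dom c g -> chart_inv c (c g) = g.
Proof.
have [/(_ c) h _ _] := @lie_atlasP R r G => /h[_ _ cK _ _] dg.
by apply: cK; rewrite inE.
Qed.

Lemma lie_chart_cod c g : chart_dom c g -> chart_cod c (c g).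
Proof. by move=> dg; exists g. Qed.

Lemma lie_chart_invK c x : lie_atlas G c -> chart_cod c x -> c (chart_inv c x) = x.
Proof. by move=> Ac [g dg <-]; rewrite lie_chartK. Qed.

Lemma lie_chart_inv_dom c x :
  lie_atlas G c -> chart_cod c x -> chart_dom c (chart_inv c x).
Proof. by move=> Ac [g dg <-]; rewrite lie_chartK. Qed.

Lemma lie_chart_dom_open c : lie_atlas G c -> open (chart_dom c).
Proof. by have [/(_ c) h _ _] := @lie_atlasP R r G => /h[]. Qed.

Lemma lie_chart_cod_open c : lie_atlas G c -> open (chart_cod c).
Proof. by have [/(_ c) h _ _] := @lie_atlasP R r G => /h[]. Qed.

Lemma lie_chart_continuous c g :
  lie_atlas G c -> chart_dom c g -> {for g, continuous c}.
Proof. by have [/(_ c) h _ _] := @lie_atlasP R r G => /h[_ _ _ + _]; apply. Qed.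

Lemma lie_chart_inv_continuous c x :
  lie_atlas G c -> chart_cod c x -> {for x, continuous (chart_inv c)}.
Proof. by have [/(_ c) h _ _] := @lie_atlasP R r G => /h[_ _ _ _]; apply. Qed.

Lemma lie_chart_at g : exists2 c, lie_atlas G c & chart_dom c g.
Proof. by have [_ + _] := @lie_atlasP R r G; apply. Qed.

Lemma cvg_lie_mul {T} (F : set_system T) {FF : Filter F} (f f' : T -> G) g h :
  f @ F --> g -> f' @ F --> h -> (f x * f' x)%g @[x --> F] --> (g * h)%g.
Proof.
move=> fg fh; have [/(_ (g, h) I) cm _] := @lie_mul_smooth R r G.
have fgh : (f x, f' x) @[x --> F] --> (g, h) by exact: cvg_pair.
exact: (cvg_comp _ _ fgh cm).
Qed.

Lemma cvg_lie_inv {T} (F : set_system T) {FF : Filter F} (f : T -> G) g :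
  f @ F --> g -> (f x)^-1%g @[x --> F] --> (g^-1)%g.
Proof.
move=> fg; have [/(_ g I) cm _] := @lie_inv_smooth R r G.
exact: (cvg_comp _ _ fg cm).
Qed.

Lemma lie_cvg_unique {T} (F : set_system T) {FF : ProperFilter F} (f : T -> G) g h :
  f @ F --> g -> f @ F --> h -> g = h.
Proof. exact: (cvg_unique (@lie_hausdorff R r G)). Qed.

Definition mul_chart c1 c2 d (p : 'rV[R]_r * 'rV[R]_r) : 'rV[R]_r :=
  d (chart_inv c1 p.1 * chart_inv c2 p.2)%g.

Definition mul_chart_dom c1 c2 d : set ('rV[R]_r * 'rV[R]_r) :=
  (chart_cod c1 `*` chart_cod c2) `&`
  (fun p => (chart_inv c1 p.1 * chart_inv c2 p.2)%g) @^-1` chart_dom d.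

Definition inv_chart c d (x : 'rV[R]_r) : 'rV[R]_r := d (chart_inv c x)^-1%g.

Definition inv_chart_dom c d : set 'rV[R]_r :=
  chart_cod c `&` (fun x => (chart_inv c x)^-1%g) @^-1` chart_dom d.

Lemma mul_chart_dom_open c1 c2 d :
  lie_atlas G c1 -> lie_atlas G c2 -> lie_atlas G d -> open (mul_chart_dom c1 c2 d).
Proof.
move=> A1 A2 Ad; apply: open_setI_preimage; last exact: lie_chart_dom_open.
  by apply: open_prod; exact: lie_chart_cod_open.
move=> -[x y] [/= cx cy]; apply: cvg_lie_mul.
  apply: (@continuous_comp _ _ _ fst (chart_inv c1) (x, y)); first exact: cvg_fst.
  exact: lie_chart_inv_continuous.
apply: (@continuous_comp _ _ _ snd (chart_inv c2) (x, y)); first exact: cvg_snd.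
exact: lie_chart_inv_continuous.
Qed.

Lemma inv_chart_dom_open c d :
  lie_atlas G c -> lie_atlas G d -> open (inv_chart_dom c d).
Proof.
move=> Ac Ad; apply: open_setI_preimage; last exact: lie_chart_dom_open.
  exact: lie_chart_cod_open.
by move=> x cx; exact: cvg_lie_inv (lie_chart_inv_continuous Ac cx).
Qed.

Lemma mul_chart_smooth c1 c2 d :
  lie_atlas G c1 -> lie_atlas G c2 -> lie_atlas G d ->
  smooth_on (mul_chart_dom c1 c2 d) (mul_chart c1 c2 d).
Proof.
move=> A1 A2 Ad k; have [_ sm] := @lie_mul_smooth R r G.
have A12 : prod_atlas (lie_atlas G) (lie_atlas G) (prod_chart c1 c2).
  by exists c1 => //; exists c2.
apply: C_on_sub (sm _ _ A12 Ad k) => -[x y] [[/= cx cy] dxy].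
exists (chart_inv c1 x, chart_inv c2 y); last by rewrite /= !lie_chart_invK.
by split => //; split => //; split; exact: lie_chart_inv_dom.
Qed.

Lemma inv_chart_smooth c d :
  lie_atlas G c -> lie_atlas G d -> smooth_on (inv_chart_dom c d) (inv_chart c d).
Proof.
move=> Ac Ad k; have [_ sm] := @lie_inv_smooth R r G.
apply: C_on_sub (sm _ _ Ac Ad k) => x [cx dx].
exists (chart_inv c x); last by rewrite lie_chart_invK.
by split => //; split => //; exact: lie_chart_inv_dom.
Qed.

End LieGroupCharts.

Section UnitChart.
Context {R : realType} {r : nat} {G : lieGroupType R r}.
Variable c : chart G 'rV[R]_r.
Hypothesis hc : is_unit_chart c.
Local Notation e := (c 1%g).
Implicit Types (d : chart G 'rV[R]_r) (g h : G) (x y : 'rV[R]_r).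

Let Ac : lie_atlas G c := proj1 hc.
Let dc1 : chart_dom c 1%g := proj2 hc.

Lemma unit_chart_cod : chart_cod c e. Proof. exact: lie_chart_cod. Qed.

Lemma unit_chart_inv : chart_inv c e = 1%g. Proof. exact: lie_chartK. Qed.

Lemma unit_chart_inv_cvg : chart_inv c x @[x --> e] --> (1%g : G).
Proof.
rewrite -{2}unit_chart_inv.
exact: (lie_chart_inv_continuous Ac unit_chart_cod).
Qed.

Lemma near_unit_cod : \forall x \near e, chart_cod c x.
Proof.
apply: open_nbhs_nbhs; split; last exact: unit_chart_cod.
exact: lie_chart_cod_open.
Qed.

Lemma near_unit_translate d g h : lie_atlas G d -> chart_dom d (g * h)%g ->
  \forall x \near e, chart_dom d (g * chart_inv c x * h)%g.
Proof.
move=> Ad dgh.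
have : (g * chart_inv c x * h)%g @[x --> e] --> (g * h)%g.
  have := cvg_lie_mul (cvg_lie_mul (cvg_cst g) unit_chart_inv_cvg) (cvg_cst h).
  by rewrite mulg1; apply.
by apply; apply: open_nbhs_nbhs; split => //; exact: lie_chart_dom_open.
Qed.

Lemma differentiable_mul_chart c1 c2 d (p : 'rV[R]_r * 'rV[R]_r) :
  lie_atlas G c1 -> lie_atlas G c2 -> lie_atlas G d ->
  mul_chart_dom c1 c2 d p -> differentiable (mul_chart c1 c2 d) p.
Proof.
by move=> A1 A2 Ad; have [/(_ p)] := mul_chart_smooth A1 A2 Ad 1%N.
Qed.

(** No single chart need contain both 1 and the image, so the map is factored: left translation into
    a chart [cg] around [g], then right translation by [h] into [d], each a partial map of the
    product in suitable charts. *)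
Lemma differentiable_translate d g h :
  lie_atlas G d -> chart_dom d (g * h)%g ->
  differentiable (fun x => d (g * chart_inv c x * h)%g) e.
Proof.
move=> Ad dgh.
have [cg Acg dg] := lie_chart_at g; have [ch Ach dh] := lie_chart_at h.
pose f1 x := mul_chart cg c cg (cg g, x).
pose f2 x := mul_chart cg ch d (x, ch h).
have f1e : f1 e = cg g.
  by rewrite /f1 /mul_chart /= unit_chart_inv mulg1 lie_chartK.
have df1 : differentiable f1 e.
  apply: (@differentiable_comp _ _ _ _ (fun x => (cg g, x)) (mul_chart cg c cg)).
    by apply: differentiable_pair.
  apply: differentiable_mul_chart => //; split; first split.
  - exact: lie_chart_cod.
  - exact: lie_chart_cod.
  - by rewrite /= unit_chart_inv mulg1 lie_chartK.
have df2 : differentiable f2 (f1 e).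
  rewrite f1e.
  apply: (@differentiable_comp _ _ _ _ (fun x => (x, ch h)) (mul_chart cg ch d)).
    by apply: differentiable_pair.
  apply: differentiable_mul_chart => //; split; first split.
  - exact: lie_chart_cod.
  - exact: lie_chart_cod.
  - by rewrite /= !lie_chartK.
apply: near_eq_differentiable (differentiable_comp df1 df2).
have := @near_unit_translate cg g 1%g Acg; rewrite mulg1 => /(_ dg).
apply: filterS => x; rewrite mulg1 => dx.
by rewrite /f1 /f2 /= /mul_chart /= (lie_chartK Acg dg) !lie_chartK.
Qed.

(** Both partial maps at the unit are the identity near [e], and the differential is the sum of its
    two partial ones. *)
Lemma is_diff_mul_unit :
  is_diff (e, e) (mul_chart c c c) (fun u => u.1 + u.2).
Proof.
have dm : differentiable (mul_chart c c c) (e, e).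
  apply: differentiable_mul_chart => //; split; first by split; exact: unit_chart_cod.
  by rewrite /= unit_chart_inv mulg1.
apply: DiffDef => //; apply/funext => -[u w] /=.
have -> : (u, w) = (u, 0) + (0, w) :> 'rV[R]_r * 'rV[R]_r.
  by congr pair; rewrite /= ?addr0 ?add0r.
rewrite linearD; congr (_ + _).
  have D : is_diff e (fun x => (x, e)) (fun u => (u, 0)) by exact: is_diff_pair.
  have [_ /(congr1 (@^~ u)) /= <-] := @is_diff_comp _ _ _ _ _ _ _ _ e D (differentiableP dm).
  rewrite (@near_eq_diff _ _ _ _ id) ?diff_id//.
  - by rewrite (@diff_val _ _ _ _ _ _ _ (is_diff_id e)).
  - apply: filterS near_unit_cod => x cx.
    by rewrite /= /mul_chart /= unit_chart_inv mulg1 lie_chart_invK.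
have D : is_diff e (fun x => (e, x)) (fun u => (0, u)) by exact: is_diff_pair.
have [_ /(congr1 (@^~ w)) /= <-] := @is_diff_comp _ _ _ _ _ _ _ _ e D (differentiableP dm).
rewrite (@near_eq_diff _ _ _ _ id) ?diff_id//.
- by rewrite (@diff_val _ _ _ _ _ _ _ (is_diff_id e)).
- apply: filterS near_unit_cod => x cx.
  by rewrite /= /mul_chart /= unit_chart_inv mul1g lie_chart_invK.
Qed.

(** The chart is a total function, so differentiability of [c \o gam] does not by itself keep [gam]
    in the domain of [c]. Continuity in [G] does, and then the chain rule applies through the
    chart. *)
Lemma is_derive_along_curve (W : normedModType R) (f : G -> W) (gam : R -> G)
    (t : R) (v : 'rV[R]_r) :
  gam t = 1%g -> {for t, continuous gam} -> is_derive t 1 (c \o gam) v ->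
  differentiable (f \o chart_inv c) e ->
  is_derive t 1 (f \o gam) ('d (f \o chart_inv c) e v).
Proof.
move=> gt cgam /is_derive1_is_diff Dg df; apply/is_derive1_is_diff.
have De : is_diff ((c \o gam) t) (f \o chart_inv c) ('d (f \o chart_inv c) e).
  by rewrite /= gt; exact: differentiableP.
have := is_diff_comp Dg De; rewrite -[_ \o _ \o _]/(_ \o _) => D.
have {}D : is_diff t ((f \o chart_inv c) \o (c \o gam))
    ( *:%R^~ ('d (f \o chart_inv c) e v)).
  by apply: is_diff_eq D _; apply/funext => s /=; rewrite linearZ.
apply: near_eq_is_diff D.
have : \forall s \near t, chart_dom c (gam s).
  apply: cgam; rewrite gt; apply: open_nbhs_nbhs; split => //.
  exact: lie_chart_dom_open.
by apply: filterS => s ds; rewrite /= lie_chartK.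
Qed.

End UnitChart.

(** * Powers in a chart *)

Section GeometricSteps.
Context {R : realType}.

Lemma cvg_geometric_steps n (u : nat -> 'rV[R]_n) (K : R) :
  (forall k, `|u k.+1 - u k| <= K / 2 ^+ k) -> cvgn u.
Proof.
move=> uK.
have K0 : 0 <= K by have := uK 0%N; rewrite expr0 divr1; exact: le_trans.
pose V : completeNormedModType R := HB.pack 'rV[R]_n (Complete.on 'rV[R]_n).
have cs : cvgn [normed series (telescope u)].
  refine (@series_le_cvg _ _ (geometric K 2^-1) _ _ _ _) => [k|k|k|].
  - exact: normr_ge0.
  - by rewrite /geometric /= mulr_ge0 // exprn_ge0.
  - by rewrite /geometric /= exprVn; exact: uK.
  - by apply: is_cvg_geometric_series; rewrite ger0_norm // invf_lt1 // ltr1n.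
have /cvg_ex[l ul] := @normed_cvg R V _ cs.
apply/cvg_ex; exists (u 0%N + l).
have uE : u = (fun k => u 0%N + series (telescope u) k).
  by apply/funext => k; exact: eq_sum_telescope.
have cu0 : (fun=> u 0%N) @ \oo --> u 0%N by exact: cvg_cst.
by rewrite [X in X @ _ --> _]uE; exact: cvgD cu0 ul.
Qed.

End GeometricSteps.

Section PowersInChart.
Context {R : realType} {r : nat} {G : lieGroupType R r}.
Variable c : chart G 'rV[R]_r.
Hypothesis hc : is_unit_chart c.
Local Notation e := (c 1%g).

(** The word unit refers to the neutral element of [G], the centre of the ball; the radius is
    [d]. *)
Definition unit_ball (d : R) (g : G) : Prop := chart_dom c g /\ `|c g - e| < d.

(* In the coordinates of [c], the product differs from the sum by a term whose
   mixed second difference is bounded by [C]. *)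
Definition mul_estimate (C d : R) : Prop :=
  [/\ 0 <= C, 0 < d, forall x, `|x - e| < d -> chart_cod c x &
   forall g g' h h', unit_ball d g -> unit_ball d g' ->
     unit_ball d h -> unit_ball d h' -> chart_dom c (g * h)%g /\
     `|c (g * h)%g - c (g' * h)%g - c (g * h')%g + c (g' * h')%g| <=
       C * `|c g - c g'| * `|c h - c h'|].

Lemma mul_sqr_le (a x : R) : 0 <= x -> a * x <= 1 -> a * x ^+ 2 <= x.
Proof. by move=> x0 ax; rewrite expr2 mulrA ler_piMl. Qed.

Lemma mul_estimate_exists : exists C d, mul_estimate C d.
Proof.
have [Ac dc1] := hc.
have oW := mul_chart_dom_open Ac Ac Ac.
have We : mul_chart_dom c c c (e, e).
  split; first by split; exact: unit_chart_cod.
  by rewrite /= (unit_chart_inv hc) mulg1.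
have [C C0 [d1 d10 dP]] := mixed_difference (has_frame_rV r) (has_frame_rV r)
  oW We (mul_chart_smooth Ac Ac Ac 2).
have /nbhs_ballP[d2 /= d20 d2P] : nbhs (e, e) (mul_chart_dom c c c).
  exact: open_nbhs_nbhs.
(* Below [d1] the mixed difference is bounded; below [d2] both factors are coordinates of group
   elements whose product stays in the chart. *)
exists C, (Num.min d1 d2); split => //.
- by rewrite lt_min d10.
- move=> x; rewrite lt_min => /andP[_ xd].
  have [] := d2P (x, e); last by case.
  by split; rewrite -ball_normE /= distrC ?subrr ?normr0.
move=> g g' h h' [dg]; rewrite lt_min => /andP[g1 g2].
move=> [dg']; rewrite lt_min => /andP[g1' g2'].
move=> [dh]; rewrite lt_min => /andP[h1 h2].
move=> [dh']; rewrite lt_min => /andP[h1' h2']; split.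
  have [] := d2P (c g, c h).
    by split; rewrite -ball_normE /= distrC.
  by move=> _; rewrite /= !lie_chartK.
have := dP (c g) (c g') (c h) (c h') g1 g1' h1 h1'.
by rewrite /mul_chart /= !lie_chartK.
Qed.

Variables (C d : R).
Hypothesis Cd : mul_estimate C d.
Let C0 : 0 <= C. Proof. by have [] := Cd. Qed.
Let d0 : 0 < d. Proof. by have [] := Cd. Qed.
Local Notation k g := (c g - e).

Lemma unit_ball1 : unit_ball d 1%g.
Proof. by split; [exact: (proj2 hc)|rewrite subrr normr0]. Qed.

Lemma mul_dom g h : unit_ball d g -> unit_ball d h -> chart_dom c (g * h)%g.
Proof. by have [_ _ _ H] := Cd => Bg Bh; have [] := H g g h h Bg Bg Bh Bh. Qed.

(** The mixed difference with g' = h' = 1. Setting only one of the two to 1 gives the Lipschitz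
    bounds [mul_sub_l] and [mul_sub_r]. *)
Lemma mul_sub_add g h : unit_ball d g -> unit_ball d h ->
  `|k (g * h)%g - k g - k h| <= C * `|k g| * `|k h|.
Proof.
have [_ _ _ H] := Cd => Bg Bh.
have [_] := H g 1%g h 1%g Bg unit_ball1 Bh unit_ball1.
rewrite mul1g !mulg1; apply: le_trans; rewrite le_eqVlt; apply/orP; left; apply/eqP.
congr (`|_|); apply/rowP => i; rewrite !mxE; ring.
Qed.

Lemma mul_sub_l g g' h : unit_ball d g -> unit_ball d g' -> unit_ball d h ->
  `|c (g * h)%g - c (g' * h)%g| <= (1 + C * `|k h|) * `|c g - c g'|.
Proof.
have [_ _ _ H] := Cd => Bg Bg' Bh.
have [_] := H g g' h 1%g Bg Bg' Bh unit_ball1; rewrite !mulg1 => le.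
have -> : c (g * h)%g - c (g' * h)%g =
   (c (g * h)%g - c (g' * h)%g - c g + c g') + (c g - c g').
  by apply/rowP => i; rewrite !mxE; ring.
apply: le_trans (ler_normD _ _) _; rewrite mulrDl mul1r addrC lerD2l.
by rewrite mulrAC.
Qed.

Lemma mul_sub_r g h h' : unit_ball d g -> unit_ball d h -> unit_ball d h' ->
  `|c (g * h)%g - c (g * h')%g| <= (1 + C * `|k g|) * `|c h - c h'|.
Proof.
have [_ _ _ H] := Cd => Bg Bh Bh'.
have [_] := H g 1%g h h' Bg unit_ball1 Bh Bh'; rewrite !mul1g => le.
have -> : c (g * h)%g - c (g * h')%g =
   (c (g * h)%g - c h - c (g * h')%g + c h') + (c h - c h').
  by apply/rowP => i; rewrite !mxE; ring.
by apply: le_trans (ler_normD _ _) _; rewrite mulrDl mul1r addrC lerD2l.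
Qed.

(** Applied to [g] and its inverse, [mul_sub_add] bounds the sum by C |k g| |k g^-1|. As C |k g| is
    at most 1/2, the same inequality forces |k g^-1| to be at most 2 |k g|. *)
Lemma inv_add g : unit_ball d g -> unit_ball d g^-1%g -> C * `|k g| <= 2^-1 ->
  `|k g^-1%g + k g| <= 2 * C * `|k g| ^+ 2.
Proof.
move=> Bg Bi Cg; have := mul_sub_add Bg Bi; rewrite mulgV subrr sub0r -opprD normrN => le.
rewrite addrC; apply: le_trans le _.
have : `|k g^-1%g| <= `|k g| + 2^-1 * `|k g^-1%g|.
  have -> : k g^-1%g = (k g + k g^-1%g) - k g by rewrite addrAC subrr add0r.
  apply: le_trans (ler_normB _ _) _; rewrite addrC lerD2l.
  have := mul_sub_add Bg Bi; rewrite mulgV subrr sub0r -opprD normrN => le.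
  have -> : (k g + k g^-1%g) - k g = k g^-1%g by rewrite addrAC subrr add0r.
  by apply: le_trans le _; rewrite ler_wpM2r.
move: (normr_ge0 (k g)) (normr_ge0 (k g^-1%g)) Cg.
move: (`|k g|) (`|k g^-1%g|) => a b a0 b0 Ca ba.
have b2a : b <= 2 * a by lra.
have -> : 2 * C * a ^+ 2 = C * a * (2 * a) by ring.
by apply: ler_wpM2l => //; rewrite mulr_ge0.
Qed.

(** With a = |k g|, the bound C rho <= 1 makes the error at stage n at most n a, so |k (g^n)| <= 2 n
    a <= 2 rho < d and the next product stays in the chart. That product adds at most 2 n C a^2 to
    the error, which fits in C ((n+1) a)^2 - C (n a)^2. *)
Lemma expg_estimate (rho : R) g N n : 2 * rho < d -> C * rho <= 1 ->
  chart_dom c g -> N%:R * `|k g| <= rho -> (n <= N)%N ->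
  chart_dom c (g ^+ n)%g /\
  `|k (g ^+ n)%g - n%:R *: k g| <= C * (n%:R * `|k g|) ^+ 2.
Proof.
move=> rd Cr dg Ng; elim: n => [|n IH] nN.
  split; first exact: (proj2 hc).
  by rewrite subrr scale0r subr0 normr0 mul0r expr0n mulr0.
have [dn en] := IH (ltnW nN).
have nNR : n.+1%:R <= N%:R :> R by rewrite ler_nat.
have a0 := normr_ge0 (k g); set a := `|k g| in Ng en a0 *.
have n1a : n.+1%:R * a <= rho by apply: le_trans Ng; rewrite ler_wpM2r.
have na : n%:R * a <= n.+1%:R * a by rewrite ler_wpM2r // ler_nat.
have na0 : 0 <= n%:R * a by rewrite mulr_ge0.
have aa : a <= n.+1%:R * a by rewrite ler_peMl // ler1n.
have kn : `|k (g ^+ n)%g| <= 2 * (n%:R * a).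
  rewrite -[k (g ^+ n)%g](subrK (n%:R *: k g)).
  apply: le_trans (ler_normD _ _) _; rewrite normrZ ger0_norm // -/a.
  suff : C * (n%:R * a) ^+ 2 <= n%:R * a by move: en; lra.
  apply: mul_sqr_le => //; apply: le_trans Cr.
  by rewrite ler_wpM2l //; apply: le_trans n1a.
have Bg : unit_ball d g by split => //; rewrite -/a; lra.
have Bn : unit_ball d (g ^+ n)%g by split => //; lra.
rewrite expgSr; split; first exact: mul_dom.
have -> : k (g ^+ n * g)%g - n.+1%:R *: k g =
  (k (g ^+ n * g)%g - k (g ^+ n)%g - k g) + (k (g ^+ n)%g - n%:R *: k g).
  by rewrite -natr1; apply/rowP => i; rewrite !mxE; ring.
apply: le_trans (ler_normD _ _) _.
have := mul_sub_add Bn Bg; rewrite -/a => m.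
have m' : C * `|k (g ^+ n)%g| * a <= C * (2 * (n%:R * a)) * a.
  by rewrite ler_wpM2r // ler_wpM2l.
have -> : C * (n.+1%:R * a) ^+ 2 =
    C * (2 * (n%:R * a)) * a + C * (n%:R * a) ^+ 2 + C * a ^+ 2.
  by rewrite -natr1; ring.
have : 0 <= C * a ^+ 2 by rewrite mulr_ge0 // sqr_ge0.
move: (le_trans m m') en; lra.
Qed.

Lemma expg_norm (rho : R) g N n : 2 * rho < d -> C * rho <= 1 ->
  chart_dom c g -> N%:R * `|k g| <= rho -> (n <= N)%N ->
  `|k (g ^+ n)%g| <= 2 * (n%:R * `|k g|).
Proof.
move=> rd Cr dg Ng nN; have [_ en] := expg_estimate rd Cr dg Ng nN.
rewrite -[k (g ^+ n)%g](subrK (n%:R *: k g)).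
apply: le_trans (ler_normD _ _) _; rewrite normrZ ger0_norm //.
suff : C * (n%:R * `|k g|) ^+ 2 <= n%:R * `|k g| by move: en; lra.
apply: mul_sqr_le; first by rewrite mulr_ge0.
apply: le_trans Cr.
by rewrite ler_wpM2l //; apply: le_trans Ng; rewrite ler_wpM2r // ler_nat.
Qed.

(** The next powers are compared through g'^m g: right multiplication by g expands the distance by
    at most 1 + C |k g|, and exchanging the last factor costs at most 2 |c g - c g'|. As N C |k g|
    <= 1, the growth factor stays below 2, whence the 4. *)
Lemma expg_lipschitz g g' N n :
  (forall n, (n <= N)%N -> unit_ball d (g ^+ n)%g) ->
  (forall n, (n <= N)%N -> unit_ball d (g' ^+ n)%g) ->
  C * d <= 1 -> N%:R * (C * `|k g|) <= 1 -> (n <= N)%N ->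
  `|c (g ^+ n)%g - c (g' ^+ n)%g| <= 4 * n%:R * `|c g - c g'|.
Proof.
move=> Bg Bg' Cd1 Ng nN.
have ep0 : 0 <= C * `|k g| by rewrite mulr_ge0.
set ep := C * `|k g| in Ng ep0 *; set D := `|c g - c g'|.
have D0 : 0 <= D by exact: normr_ge0.
have nep m : (m <= N)%N -> m%:R * ep <= 1.
  by move=> mN; apply: le_trans Ng; rewrite ler_wpM2r // ler_nat.
(* The factor [1 + m * ep] absorbs the growth of the error by [1 + ep] per step. *)
suff main : forall m, (m <= N)%N ->
    `|c (g ^+ m)%g - c (g' ^+ m)%g| <= 2 * m%:R * (1 + m%:R * ep) * D.
  apply: le_trans (main n nN) _; rewrite ler_wpM2r //.
  have : n%:R * (1 + n%:R * ep) <= n%:R * 2.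
    by rewrite ler_wpM2l //; have := nep n nN; lra.
  lra.
elim=> [|m IH] mN; first by rewrite subrr normr0 mulr0 !mul0r.
have Bm := Bg _ (ltnW mN); have Bm' := Bg' _ (ltnW mN).
have N1 : (1 <= N)%N by exact: leq_trans mN.
have B1 := Bg _ N1; have B1' := Bg' _ N1; rewrite !expg1 in B1 B1'.
rewrite !expgSr.
rewrite -[c (g ^+ m * g)%g](subrK (c (g' ^+ m * g)%g)) -addrA.
apply: le_trans (ler_normD _ _) _.
have h1 := mul_sub_l Bm Bm' B1; rewrite -/ep in h1.
have h2 := mul_sub_r Bm' B1 B1'; rewrite -/D in h2.
have h3 : (1 + C * `|k (g' ^+ m)%g|) * D <= 2 * D.
  rewrite ler_wpM2r //; suff : C * `|k (g' ^+ m)%g| <= 1 by lra.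
  by apply: le_trans Cd1; rewrite ler_wpM2l // ltW //; have [] := Bm'.
have h4 : (1 + ep) * `|c (g ^+ m)%g - c (g' ^+ m)%g| <=
    (1 + ep) * (2 * m%:R * (1 + m%:R * ep) * D).
  by rewrite ler_wpM2l ?addr_ge0 //; exact/IH/ltnW.
have h5 : (1 + ep) * (2 * m%:R * (1 + m%:R * ep) * D) + 2 * D <=
    2 * m.+1%:R * (1 + m.+1%:R * ep) * D.
  rewrite -[m.+1%:R]natr1 -subr_ge0.
  have -> : 2 * (m%:R + 1) * (1 + (m%:R + 1) * ep) * D -
    ((1 + ep) * (2 * m%:R * (1 + m%:R * ep) * D) + 2 * D) =
    2 * ep * (1 + m%:R * (1 - m%:R * ep)) * D by ring.
  rewrite mulr_ge0 // mulr_ge0 ?mulr_ge0 // addr_ge0 // mulr_ge0 // subr_ge0.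
  exact/nep/ltnW.
move: h1 h2 h3 h4 h5; lra.
Qed.

End PowersInChart.

(** * Dyadic construction of one-parameter subgroups *)

Section Truncation.
Context {R : realType}.

Lemma truncn_add (x y : R) : 0 <= x -> 0 <= y ->
  exists b : bool, Num.trunc (x + y) = (Num.trunc x + Num.trunc y + b)%N.
Proof.
move=> x0 y0; have := truncn_itv x0; have := truncn_itv y0.
move: (Num.trunc x) (Num.trunc y) => m n /andP[ny yn] /andP[mx xm].
have [lt|ge] := ltP (x + y) ((m + n).+1%:R).
  exists false; rewrite addn0; apply: truncn_def; rewrite lt andbT natrD.
  exact: lerD.
exists true; rewrite addn1; apply: truncn_def; rewrite ge /=.
apply: lt_le_trans (ltrD xm yn) _.
by rewrite -natrD ler_nat addSn addnS.
Qed.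

Lemma cvg_truncn_dyadic (t : R) : 0 <= t ->
  (Num.trunc (t * 2 ^+ n))%:R / 2 ^+ n @[n --> \oo] --> t.
Proof.
move=> t0.
have p0 n : 0 < 2 ^+ n :> R by rewrite exprn_gt0.
have lo : t - 2^-1 ^+ n @[n --> \oo] --> t.
  rewrite -[X in _ --> X]subr0; apply: cvgB; first exact: cvg_cst.
  by apply: cvg_expr; rewrite ger0_norm // invf_lt1 // ltr1n.
apply: (squeeze_cvgr _ lo (cvg_cst t)); near=> n.
have tn : 0 <= t * 2 ^+ n by rewrite mulr_ge0 // ltW.
have /andP[h1 h2] := truncn_itv tn; apply/andP; split.
  rewrite ler_pdivlMr // mulrBl exprVn mulVf ?gt_eqF // lerBlDr.
  by rewrite natr1 ltW.
by rewrite ler_pdivrMr.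
Unshelve. all: by end_near. Qed.

End Truncation.

Section DyadicLimit.
Context {R : realType} {r : nat} {G : lieGroupType R r}.
Variable c : chart G 'rV[R]_r.
Hypothesis hc : is_unit_chart c.
Local Notation e := (c 1%g).
Local Notation k g := (c g - e).

Lemma mul_estimate_small : exists C d, mul_estimate c C d /\ C * d <= 1.
Proof.
have [C [d [C0 d0 H1 H2]]] := mul_estimate_exists hc.
have C1 : 0 < C + 1 by rewrite ltr_wpDl.
(* The bound uses C + 1 because [C] may be 0. *)
exists C, (Num.min d (C + 1)^-1); split; last first.
  apply: (@le_trans _ _ (C * (C + 1)^-1)); first by rewrite ler_wpM2l // ge_min lexx orbT.
  by rewrite ler_pdivrMr // mul1r lerDl.
have sub g : unit_ball c (Num.min d (C + 1)^-1) g -> unit_ball c d g.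
  by move=> [dg]; rewrite lt_min => /andP[].
split => //.
- by rewrite lt_min d0 invr_gt0.
- by move=> x; rewrite lt_min => /andP[/H1].
- by move=> g g' h h' /sub Bg /sub Bg' /sub Bh /sub Bh'; exact: H2.
Qed.

Variables (C d : R).
Hypothesis Cd : mul_estimate c C d.
Hypothesis Cd1 : C * d <= 1.
Variable v : 'rV[R]_r.
Hypothesis vd : 2 * `|v| < d.

Let C0 : 0 <= C. Proof. by have [] := Cd. Qed.
Let d0 : 0 < d. Proof. by have [] := Cd. Qed.
Let Ac : lie_atlas G c := proj1 hc.

(* An approximation of the [2 ^ n]-th root of [exp v]. *)
Definition dyadic_root (n : nat) : G := chart_inv c (e + (2 ^+ n)^-1 *: v).

Definition dyadic_power (n : nat) (t : R) : G :=
  (dyadic_root n ^+ Num.trunc (t * 2 ^+ n))%g.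

Let p0 n : 0 < 2 ^+ n :> R. Proof. by rewrite exprn_gt0. Qed.

Let root_norm n : `|(2 ^+ n)^-1 *: v| = `|v| / 2 ^+ n.
Proof. by rewrite normrZ ger0_norm ?invr_ge0 ?(ltW (p0 n)) // mulrC. Qed.

Let vd1 : `|v| < d.
Proof. by apply: le_lt_trans vd; rewrite ler_peMl // ler1n. Qed.

Let root_cod n : chart_cod c (e + (2 ^+ n)^-1 *: v).
Proof.
have [_ _ H _] := Cd; apply: H; rewrite [e + _]addrC addrK root_norm.
apply: le_lt_trans vd1.
by rewrite ler_pdivrMr // ler_peMr // exprn_ege1 // ler1n.
Qed.

Let root_dom n : chart_dom c (dyadic_root n).
Proof. exact: lie_chart_inv_dom. Qed.

Let root_k n : k (dyadic_root n) = (2 ^+ n)^-1 *: v.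
Proof. by rewrite lie_chart_invK // [e + _]addrC addrK. Qed.

Let root_size n : (2 ^ n)%:R * `|k (dyadic_root n)| = `|v|.
Proof. by rewrite root_k root_norm natrX mulrCA mulfV ?mulr1 // gt_eqF. Qed.

Let Cv : C * `|v| <= 1.
Proof. by apply: le_trans Cd1; rewrite ler_wpM2l // ltW. Qed.

Let root_est n m : (m <= 2 ^ n)%N ->
  chart_dom c (dyadic_root n ^+ m)%g /\
  `|k (dyadic_root n ^+ m)%g - m%:R *: k (dyadic_root n)| <=
     C * (m%:R * `|k (dyadic_root n)|) ^+ 2.
Proof.
by apply: (expg_estimate hc Cd vd Cv); rewrite ?root_size.
Qed.

Let root_ball n m : (m <= 2 ^ n)%N -> unit_ball c d (dyadic_root n ^+ m)%g.
Proof.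
move=> mn; split; first by have [] := root_est mn.
apply: le_lt_trans vd.
have := expg_norm hc Cd vd Cv (root_dom n) _ mn.
rewrite root_size => /(_ (lexx _)) h; apply: le_trans h _.
rewrite ler_wpM2l // -(root_size n) ler_wpM2r // ler_nat //.
Qed.

Let trunc_bound (t : R) n : 0 <= t <= 1 -> (Num.trunc (t * 2 ^+ n) <= 2 ^ n)%N.
Proof.
move=> /andP[t0 t1]; rewrite -(@ler_nat R) natrX.
apply: (@le_trans _ _ (t * 2 ^+ n)); last by rewrite ler_piMl // ltW.
by rewrite truncn_le mulr_ge0 // ltW.
Qed.

(** Doubling t 2^n turns its integer part m into 2 m + b with a bit b. The bit costs one factor
    q_(n+1), that is at most |v| / 2^n. The rest compares (q_(n+1)^2)^m with q_n^m: the bases differ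
    by at most C (|v| / 2^n)^2, and the Lipschitz bound for powers multiplies this by at most 4 *
    2^n. *)
Lemma dyadic_power_step (t : R) n : 0 <= t <= 1 ->
  `|c (dyadic_power n.+1 t) - c (dyadic_power n t)| <=
    (`|v| + 4 * C * `|v| ^+ 2) / 2 ^+ n.
Proof.
move=> t01; have /andP[t0 t1] := t01.
have tn0 : 0 <= t * 2 ^+ n by rewrite mulr_ge0 // ltW.
have [b bE] := truncn_add tn0 tn0.
have := trunc_bound n.+1 t01; rewrite /dyadic_power.
have -> : t * 2 ^+ n.+1 = t * 2 ^+ n + t * 2 ^+ n by rewrite exprS; ring.
rewrite bE addnn; have := trunc_bound n t01.
move: (Num.trunc _) => m mn mbn.
have m2n : (m.*2 <= 2 ^ n.+1)%N by rewrite expnS mul2n leq_double.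
rewrite -[c (_ ^+ (_ + b))%g](subrK (c (dyadic_root n.+1 ^+ m.*2)%g)) -addrA.
apply: le_trans (ler_normD _ _) _; rewrite mulrDl; apply: lerD.
  have v2n : 0 <= `|v| / 2 ^+ n by rewrite divr_ge0 // ltW.
  case: b mbn bE => mbn _; last by rewrite addn0 subrr normr0.
  have B1 : unit_ball c d (dyadic_root n.+1).
    by rewrite -[dyadic_root _]expg1; apply: root_ball; rewrite expn_gt0.
  have h := mul_sub_r hc Cd (root_ball m2n) B1 (unit_ball1 hc Cd).
  rewrite mulg1 root_k root_norm in h; rewrite addn1 expgSr.
  have bk : C * `|k (dyadic_root n.+1 ^+ m.*2)%g| <= 1.
    by apply: le_trans Cd1; rewrite ler_wpM2l // ltW //; have [] := root_ball m2n.
  apply: le_trans h _; apply: (@le_trans _ _ (2 * (`|v| / 2 ^+ n.+1))).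
    by rewrite ler_wpM2r ?divr_ge0 // ?(ltW (p0 _)) //; lra.
  by rewrite exprS invfM mulrCA [X in _ * X]mulrA mulfV // mul1r.
rewrite -mul2n expgnA distrC.
have Bq j : (j <= 2 ^ n)%N -> unit_ball c d ((dyadic_root n.+1 ^+ 2) ^+ j)%g.
  by move=> jn; rewrite -expgnA; apply: root_ball; rewrite expnS leq_mul2l.
have Cq : (2 ^ n)%:R * (C * `|k (dyadic_root n)|) <= 1.
  by rewrite mulrCA root_size.
have h := expg_lipschitz hc Cd (@root_ball n) Bq Cd1 Cq mn.
apply: le_trans h _.
have n2 : (2 <= 2 ^ n.+1)%N by rewrite expnS leq_pmulr // expn_gt0.
have [_] := root_est n2; rewrite !root_k root_norm scalerA.
have -> : 2 * (2 ^+ n.+1)^-1 = (2 ^+ n)^-1 :> R.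
  by rewrite exprS invfM mulrA mulfV // mul1r.
have -> : k (dyadic_root n.+1 ^+ 2)%g - (2 ^+ n)^-1 *: v =
    c (dyadic_root n.+1 ^+ 2)%g - c (dyadic_root n).
  by rewrite -root_k opprB addrA subrK.
have -> : 2 * (`|v| / 2 ^+ n.+1) = `|v| / 2 ^+ n.
  by rewrite exprS invfM mulrCA [X in _ * X]mulrA mulfV // mul1r.
rewrite distrC => h.
apply: (@le_trans _ _ (4 * 2 ^+ n * (C * (`|v| / 2 ^+ n) ^+ 2))).
  apply: ler_pM => //.
  by rewrite ler_wpM2l // -natrX ler_nat.
rewrite le_eqVlt; apply/orP; left; apply/eqP.
by have := p0 n; move: (2 ^+ n) => p /gt_eqF/negbT pn0; field.
Qed.

Let dyadic_est (t : R) n : 0 <= t <= 1 ->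
  chart_dom c (dyadic_power n t) /\
  `|k (dyadic_power n t) - ((Num.trunc (t * 2 ^+ n))%:R / 2 ^+ n) *: v| <=
    C * (t * `|v|) ^+ 2.
Proof.
move=> t01; have /andP[t0 t1] := t01.
have [dp h] := root_est (trunc_bound n t01); split; first exact: dp.
rewrite root_k scalerA root_norm in h; apply: le_trans h _.
rewrite ler_wpM2l // ler_sqr ?nnegrE ?mulr_ge0 // ?divr_ge0 // ?(ltW (p0 n)) //.
rewrite mulrCA [t * `|v|]mulrC ler_wpM2l // ler_pdivrMr // truncn_le.
by rewrite mulr_ge0 // ltW.
Qed.

Lemma dyadic_power_cvg01 (t : R) : 0 <= t <= 1 ->
  exists g, [/\ chart_dom c g, dyadic_power n t @[n --> \oo] --> g &
    `|k g - t *: v| <= C * (t * `|v|) ^+ 2].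
Proof.
move=> t01; have /andP[t0 t1] := t01.
have /cvg_ex[L cL] := cvg_geometric_steps (fun n => dyadic_power_step n t01).
(* All approximants lie within 2 |v| of [e], hence so does the limit; the strict inequality 2 |v| <
   d keeps it in the image of the chart. *)
have Ld : chart_cod c L.
  have [_ _ + _] := Cd; apply; apply: le_lt_trans vd.
  have cn : `|k (dyadic_power n t)| @[n --> \oo] --> `|L - e|.
    by apply: cvg_norm; apply: cvgB => //; exact: cvg_cst.
  apply: (ler_cvg_to cn (cvg_cst (2 * `|v|))); apply: nearW => n.
  have := expg_norm hc Cd vd Cv (root_dom n) _ (trunc_bound n t01).
  rewrite root_size => /(_ (lexx _)) h; apply: le_trans h _.
  by rewrite ler_wpM2l // -(root_size n) ler_wpM2r // ler_nat trunc_bound.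
exists (chart_inv c L); split; first exact: lie_chart_inv_dom.
  have PE : (fun n => dyadic_power n t) =
      chart_inv c \o (fun n => c (dyadic_power n t)).
    by apply/funext => n; rewrite /= lie_chartK //; have [] := dyadic_est n t01.
  by rewrite PE; exact: cvg_comp cL (lie_chart_inv_continuous Ac Ld).
rewrite lie_chart_invK //.
have cn : `|k (dyadic_power n t) - ((Num.trunc (t * 2 ^+ n))%:R / 2 ^+ n) *: v|
    @[n --> \oo] --> `|L - e - t *: v|.
  apply: cvg_norm; apply: cvgB; first by apply: cvgB => //; exact: cvg_cst.
  by apply: cvgZr_tmp; exact: cvg_truncn_dyadic.
apply: (ler_cvg_to cn (cvg_cst _)); apply: nearW => n.
by have [] := dyadic_est n t01.
Qed.

Let root_cvg : dyadic_root n @[n --> \oo] --> (1%g : G).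
Proof.
have ce : e + (2 ^+ n)^-1 *: v @[n --> \oo] --> e.
  have c0 : (2 ^+ n)^-1 @[n --> \oo] --> (0 : R).
    under eq_fun do rewrite -exprVn.
    by apply: cvg_expr; rewrite ger0_norm // invf_lt1 // ltr1n.
  have ccst : (fun _ : nat => e) @ \oo --> e by exact: cvg_cst.
  have cz : (2 ^+ n)^-1 *: v @[n --> \oo] --> 0 *: v by exact: cvgZr_tmp.
  by have := cvgD ccst cz; rewrite scale0r addr0; exact.
exact: cvg_comp ce (unit_chart_inv_cvg hc).
Qed.

Let root_cvg_bool (b : nat -> bool) :
  (dyadic_root n ^+ b n)%g @[n --> \oo] --> (1%g : G).
Proof.
move=> A A1; have FA : \forall n \near \oo, A (dyadic_root n) := root_cvg A1.
change (\forall n \near \oo, A (dyadic_root n ^+ b n)%g).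
apply: filterS FA => n An.
by case: (b n); [rewrite expg1|rewrite expg0; exact: nbhs_singleton A1].
Qed.

Let dyadic_power_add (s t : R) : 0 <= s -> 0 <= t ->
  exists b : nat -> bool, forall n, dyadic_power n (s + t) =
    (dyadic_power n s * dyadic_power n t * dyadic_root n ^+ b n)%g.
Proof.
move=> s0 t0.
have /choice[b bE] : forall n, exists b : bool, Num.trunc ((s + t) * 2 ^+ n) =
    (Num.trunc (s * 2 ^+ n) + Num.trunc (t * 2 ^+ n) + b)%N.
  by move=> n; rewrite mulrDl; apply: truncn_add; rewrite mulr_ge0 // ltW.
by exists b => n; rewrite /dyadic_power bE !expgnDr.
Qed.

(** The integer parts of s 2^n and t 2^n add up to that of (s + t) 2^n except for a carry, whose
    factor q_n^b tends to 1. *)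
Let dyadic_power_add_cvg (s t : R) g h : 0 <= s -> 0 <= t ->
  dyadic_power n s @[n --> \oo] --> g -> dyadic_power n t @[n --> \oo] --> h ->
  dyadic_power n (s + t) @[n --> \oo] --> (g * h)%g.
Proof.
move=> s0 t0 cg ch; have [b bE] := dyadic_power_add s0 t0.
under eq_fun do rewrite bE; rewrite -[(g * h)%g]mulg1.
by apply: cvg_lie_mul; [exact: cvg_lie_mul|exact: root_cvg_bool].
Qed.

(** The estimates hold for t <= 1 only, where the powers stay in the chart. Beyond, t is halved
    until it is at most 1, and the limit at t is the square of the limit at t / 2. *)
Lemma dyadic_power_cvg (t : R) : 0 <= t ->
  exists g : G, dyadic_power n t @[n --> \oo] --> g.
Proof.
move=> t0; have [N tN] : exists N, t <= 2 ^+ N.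
  exists (Num.trunc t).+1; apply: le_trans (ltW (truncnS_gt t)) _.
  by rewrite -natrX ler_nat ltnW // ltn_expl.
elim: N t t0 tN => [|N IH] t t0 tN.
  have [|g [_ cg _]] := @dyadic_power_cvg01 t; last by exists g.
  by rewrite t0 -(expr0 2).
have t20 : 0 <= t / 2 by rewrite divr_ge0.
have [|g cg] := IH (t / 2) t20.
  by rewrite ler_pdivrMr // -exprSr.
exists (g * g)%g; rewrite (_ : t = t / 2 + t / 2); last by field.
exact: dyadic_power_add_cvg.
Qed.

Lemma dyadic_hom_exists : exists gam : R -> G,
  (forall s t, 0 <= s -> 0 <= t -> gam (s + t) = (gam s * gam t)%g) /\
  (forall t, 0 <= t <= 1 -> chart_dom c (gam t) /\
    `|k (gam t) - t *: v| <= C * (t * `|v|) ^+ 2).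
Proof.
have /choice[gam gamP] : forall t : R, exists g : G, 0 <= t ->
    dyadic_power n t @[n --> \oo] --> g.
  (* The value 1 at negative times is a placeholder; negative times are treated by
     [extend_nonneg_hom]. *)
  move=> t; have [t0|t0] := leP 0 t; last by exists 1%g.
  by have [g cg] := dyadic_power_cvg t0; exists g.
exists gam; split=> [s t s0 t0|t t01].
  have c1 := gamP _ (addr_ge0 s0 t0).
  have c2 := dyadic_power_add_cvg s0 t0 (gamP s s0) (gamP t t0).
  exact: lie_cvg_unique c1 c2.
have [g [dg cg eg]] := dyadic_power_cvg01 t01; have /andP[t0 _] := t01.
by rewrite (lie_cvg_unique (gamP t t0) cg).
Qed.

End DyadicLimit.

Section ExtensionOfHomomorphisms.
Context {R : realType} {G : groupType}.

(** Addition of reals commutes, hence so do the values of [gam]. Therefore gam(a) gam(b)^-1 depends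
    on a - b alone and is additive in it. *)
Lemma extend_nonneg_hom (gam : R -> G) :
  (forall s t : R, 0 <= s -> 0 <= t -> gam (s + t) = (gam s * gam t)%g) ->
  exists Gam : R -> G, (forall s t, Gam (s + t) = (Gam s * Gam t)%g) /\
    (forall t, 0 <= t -> Gam t = gam t).
Proof.
move=> gamD.
have gamC (a b : R) : 0 <= a -> 0 <= b -> commute (gam a) (gam b).
  by move=> a0 b0; rewrite /commute -!gamD // addrC.
have gam0 : gam 0 = 1%g.
  by apply: (mulgI (gam 0)); rewrite -gamD // addr0 mulg1.
pose Gam (t : R) := (gam (Num.max t 0) * (gam (Num.max (- t) 0))^-1)%g.
have GamB (a b : R) : 0 <= a -> 0 <= b -> Gam (a - b) = (gam a * (gam b)^-1)%g.
  move=> a0 b0; rewrite /Gam.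
  have [ab|ba] := leP b a.
    rewrite (max_l (_ : 0 <= a - b)) ?subr_ge0 // (max_r (_ : - (a - b) <= 0)) ?oppr_le0 ?subr_ge0 //.
    by rewrite gam0 invg1 mulg1 -[in RHS](subrK b a) [in RHS]gamD ?subr_ge0 // mulgK.
  rewrite opprB (max_r (_ : a - b <= 0)) ?subr_le0 1?ltW // max_l ?subr_ge0 1?ltW //.
  have ba0 : 0 <= b - a by rewrite subr_ge0 ltW.
  by rewrite gam0 mul1g -[in RHS](subrK a b) [in RHS]gamD // invgM mulVKg.
have decomp (t : R) : exists a b, [/\ 0 <= a, 0 <= b & t = a - b].
  have [t0|t0] := leP 0 t; first by exists t, 0; split; rewrite ?subr0.
  exists 0, (- t); split => //; last by rewrite opprK add0r.
  by rewrite oppr_ge0 ltW.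
exists Gam; split=> [s t|t t0]; last by rewrite -{1}[t]subr0 GamB // gam0 invg1 mulg1.
have [a [b [a0 b0 ->]]] := decomp s; have [a' [b' [a'0 b'0 ->]]] := decomp t.
have -> : a - b + (a' - b') = (a + a') - (b + b') by ring.
rewrite !GamB ?addr_ge0 // !gamD //.
have C1 : commute (gam b)^-1%g (gam a') by apply: commute_sym; apply: commuteV; exact: gamC.
have C2 : commute (gam b) (gam b') by exact: gamC.
by rewrite C2 invgM !mulgA -[in RHS](mulgA (gam a)) C1 !mulgA.
Qed.

Lemma hom_zero (gam : R -> G) :
  (forall s t, gam (s + t) = (gam s * gam t)%g) -> gam 0 = 1%g.
Proof. by move=> h; apply: (mulgI (gam 0)); rewrite -h addr0 mulg1. Qed.

Lemma hom_opp (gam : R -> G) t :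
  (forall s t, gam (s + t) = (gam s * gam t)%g) -> gam (- t) = (gam t)^-1%g.
Proof.
move=> h; apply/esym/mulg1_eq.
by rewrite -h subrr (hom_zero h).
Qed.

Lemma hom_mulrn (gam : R -> G) t n :
  (forall s t, gam (s + t) = (gam s * gam t)%g) ->
  gam (n%:R * t) = (gam t ^+ n)%g.
Proof.
move=> h; elim: n => [|n IH]; first by rewrite mul0r (hom_zero h).
by rewrite -natr1 mulrDl mul1r h IH expgSr.
Qed.

End ExtensionOfHomomorphisms.

(** * Existence of one-parameter subgroups with prescribed velocity *)

Section OneParameterSubgroups.
Context {R : realType} {r : nat} {G : lieGroupType R r}.
Variable c : chart G 'rV[R]_r.
Hypothesis hc : is_unit_chart c.
Local Notation e := (c 1%g).
Local Notation k g := (c g - e).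
Implicit Types (v : 'rV[R]_r) (gam : R -> G).

Let Ac : lie_atlas G c := proj1 hc.
Let dc1 : chart_dom c 1%g := proj2 hc.

(* One-parameter subgroups without their smoothness, which is automatic: a
   differentiable homomorphism is an integral curve of a left-invariant field. *)
Definition differentiable_hom v gam : Prop :=
  [/\ forall s t, gam (s + t) = (gam s * gam t)%g,
      {for 0, continuous gam} & is_derive (0 : R) (1 : R) (c \o gam) v].

(** The dyadic construction estimates gam(t) for t >= 0 only. At negative times gam(-t) = gam(t)^-1
    and [inv_add] supplies a quadratic bound, so a two-sided estimate yields the derivative at 0.
    Continuity is proved in [G] itself, from the right limits of gam(t) and gam(t)^-1. *)
Lemma differentiable_hom_small : exists2 d : R, 0 < d &
  forall v, 2 * `|v| < d -> exists gam, differentiable_hom v gam.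
Proof.
have [C [d [Cd Cd1]]] := mul_estimate_small hc.
have [C0 d0 _ _] := Cd; exists d => // v vd.
have [gp [gpD gpE]] := dyadic_hom_exists hc Cd Cd1 vd.
have [gam [gamD gamE]] := extend_nonneg_hom gpD.
have gam0 := hom_zero gamD.
have est t : 0 <= t <= 1 -> chart_dom c (gam t) /\
    `|k (gam t) - t *: v| <= C * (t * `|v|) ^+ 2.
  by move=> t01; have /andP[t0 _] := t01; rewrite gamE //; exact: gpE.
(* Since t^2 <= t on [0, 1], the quadratic term joins the linear one. The resulting constant [B]
   turns the error 2 C |k (gam t)|^2 of inversion into 2 C B^2 t^2. *)
have est1 t : 0 <= t <= 1 -> `|k (gam t)| <= (`|v| + C * `|v| ^+ 2) * t.
  move=> t01; have [_ h] := est t t01; have /andP[t0 t1] := t01.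
  rewrite -[k _](subrK (t *: v)); apply: le_trans (ler_normD _ _) _.
  rewrite normrZ ger0_norm //; apply: le_trans (lerD h (lexx _)) _.
  rewrite -subr_ge0; set a := `|v|.
  have -> : (a + C * a ^+ 2) * t - (C * (t * a) ^+ 2 + t * a) =
    C * a ^+ 2 * (t * (1 - t)) by ring.
  apply: mulr_ge0; last by rewrite mulr_ge0 // subr_ge0.
  by rewrite mulr_ge0 // sqr_ge0.
set B := `|v| + C * `|v| ^+ 2 in est1.
have C1 : 0 < C + 1 by rewrite ltr_wpDl.
have B0 : 0 <= B by rewrite addr_ge0 // mulr_ge0 // sqr_ge0.
have cr : (gam t @[t --> 0^'+] --> (1%g : G))%classic.
  have ck : c (gam t) @[t --> 0^'+] --> e.
    have B1 : 0 < B + 1 by rewrite ltr_wpDl.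
    apply/cvgrPdist_le => eps eps0; near=> t.
    have t01 : 0 <= t <= 1.
      by apply/andP; split; near: t; [exact: nbhs_right_ge|exact: nbhs_right_le].
    rewrite distrC; apply: le_trans (est1 t t01) _.
    apply: (@le_trans _ _ ((B + 1) * t)).
      by rewrite ler_wpM2r ?lerDl //; case/andP: t01.
    rewrite -ler_pdivlMl //; near: t; apply: nbhs_right_le.
    by rewrite mulr_gt0 // invr_gt0.
  have := cvg_comp _ _ ck (unit_chart_inv_cvg hc); apply: cvg_trans.
  apply: near_eq_cvg; near=> t; rewrite /= lie_chartK //.
  have [|//] := est t; apply/andP.
  by split; near: t; [exact: nbhs_right_ge|exact: nbhs_right_le].
have ci : ((gam t)^-1%g @[t --> 0^'+] --> (1%g : G))%classic.
  by have := cvg_lie_inv cr; rewrite invg1; exact.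
have ball_near : \forall t \near 0^'+, [/\ 0 <= t <= 1, unit_ball c d (gam t),
    unit_ball c d (gam t)^-1%g & C * `|k (gam t)| <= 2^-1].
  have Bn : \forall g \near (1%g : G), unit_ball c d g /\ C * `|k g| <= 2^-1.
    have ckk : `|k g| @[g --> (1%g : G)] --> (0 : R).
      rewrite -(@normr0 _ 'rV[R]_r) -(subrr e); apply: cvg_norm.
      by apply: cvgB; [exact: lie_chart_continuous|exact: cvg_cst].
    near=> g; split; first split.
    - by near: g; apply: open_nbhs_nbhs; split => //; exact: lie_chart_dom_open.
    - by near: g; exact: (cvgr_lt 0 ckk).
    - apply: (@le_trans _ _ ((C + 1) * `|k g|)).
        by rewrite ler_wpM2r // lerDl.
      rewrite -ler_pdivlMl // ltW //; near: g; apply: (cvgr_lt 0 ckk).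
      by rewrite mulr_gt0 // invr_gt0.
  near=> t; split.
  - by apply/andP; split; near: t; [exact: nbhs_right_ge|exact: nbhs_right_le].
  - suff [] : unit_ball c d (gam t) /\ C * `|k (gam t)| <= 2^-1 by [].
    by near: t; exact: (cr _ Bn).
  - suff [] : unit_ball c d (gam t)^-1%g /\ C * `|k (gam t)^-1%g| <= 2^-1 by [].
    by near: t; exact: (ci _ Bn).
  - suff [] : unit_ball c d (gam t) /\ C * `|k (gam t)| <= 2^-1 by [].
    by near: t; exact: (cr _ Bn).
have sq : \forall t \near (0 : R), `|c (gam t) - (e + t *: v)| <=
    (C * `|v| ^+ 2 + 2 * C * B ^+ 2) * `|t - 0| ^+ 2.
  have pos : \forall t \near 0^'+, `|c (gam t) - (e + t *: v)| <=
      (C * `|v| ^+ 2) * t ^+ 2 /\ `|c (gam (- t)) - (e - t *: v)| <=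
      (C * `|v| ^+ 2 + 2 * C * B ^+ 2) * t ^+ 2.
    apply: filterS ball_near => t [t01 Bg Bi Cg].
    have [dg h] := est t t01.
    have h1 : `|c (gam t) - (e + t *: v)| <= (C * `|v| ^+ 2) * t ^+ 2.
      by rewrite opprD addrA -mulrA [_ * t ^+ 2]mulrC -exprMn.
    split => //; rewrite hom_opp //.
    have -> : c (gam t)^-1%g - (e - t *: v) =
        (k (gam t)^-1%g + k (gam t)) - (c (gam t) - (e + t *: v)).
      by apply/rowP => i; rewrite !mxE; ring.
    apply: le_trans (ler_normB _ _) _; rewrite addrC mulrDl; apply: lerD => //.
    apply: le_trans (inv_add hc Cd Bg Bi Cg) _.
    rewrite -[leRHS]mulrA ler_wpM2l ?mulr_ge0 // -exprMn.
    by rewrite ler_sqr ?nnegrE ?est1 ?mulr_ge0 //; case/andP: t01.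
  have [d1 d10 d1P] : exists2 d1 : R, 0 < d1 & forall t, 0 < t -> t < d1 ->
      `|c (gam t) - (e + t *: v)| <= (C * `|v| ^+ 2) * t ^+ 2 /\
      `|c (gam (- t)) - (e - t *: v)| <=
        (C * `|v| ^+ 2 + 2 * C * B ^+ 2) * t ^+ 2.
    have /nbhs_ballP[d1 /= d10 d1P] := pos; exists d1 => // t t0 td.
    by apply: d1P => //; rewrite -ball_normE /= sub0r normrN gtr0_norm.
  near=> t; rewrite subr0.
  have td : `|t| < d1.
    near: t; apply/nbhs_ballP; exists d1 => //= s.
    by rewrite -ball_normE /= sub0r normrN.
  rewrite real_normK ?num_real //.
  have K0 : 0 <= 2 * C * B ^+ 2 by rewrite !mulr_ge0.
  have [t0|t0|->] := ltgtP t 0.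
  - have [||_] := d1P (- t); rewrite ?oppr_gt0 //.
      by rewrite -(ltr0_norm t0).
    by rewrite opprK scaleNr opprK sqrrN.
  - have [||h _] := d1P t => //; first by rewrite -(gtr0_norm t0).
    apply: le_trans h _; rewrite ler_wpM2r ?sqr_ge0 // lerDl //.
  - by rewrite gam0 scale0r addr0 subrr normr0 expr0n mulr0.
have Dl : is_diff (0 : R) (fun t => e + t *: v) ( *:%R^~ v).
  have D1 := is_diff_scalel (0 : R) v.
  have D2 : is_diff (0 : R) (cst e) 0 by exact: is_diff_cst.
  refine (is_diff_eq (is_diffD D2 D1) _).
  by apply/funext => h; rewrite !fctE add0r.
have Dg := is_diff_near_sqr sq Dl.
exists gam; split => //; last exact/is_derive1_is_diff.
change (gam @ 0 --> gam 0); rewrite gam0 => A A1.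
have nA : \forall t \near 0^'+, A (gam t) /\ A (gam t)^-1%g.
  by near=> t; split; near: t; [exact: (cr _ A1)|exact: (ci _ A1)].
have /nbhs_ballP[d1 /= d10 d1P] := nA.
apply/nbhs_ballP; exists d1 => //= t; rewrite -ball_normE /= sub0r normrN => td.
have [t0|t0|->] := ltgtP t 0; last by rewrite gam0; exact: nbhs_singleton A1.
- have [||_] := d1P (- t); rewrite ?oppr_gt0 //.
    by rewrite -ball_normE /= sub0r opprK.
  by rewrite hom_opp // invgK.
- have [||//] := d1P t => //.
  by rewrite -ball_normE /= sub0r normrN.
Unshelve. all: by end_near. Qed.

Lemma differentiable_hom_scale v gam (a : R) : differentiable_hom v gam ->
  differentiable_hom (a *: v) (fun t => gam (a * t)).
Proof.
move=> [gamD cg /is_derive1_is_diff dg].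
have Da : is_diff (0 : R) (fun t : R => a * t) (fun t => a * t).
  exact: is_diff_scaler.
split.
- by move=> s t; rewrite mulrDr gamD.
- apply: (@continuous_comp _ _ _ (fun t => a * t) gam).
    by apply: differentiable_continuous; exact: ex_diff.
  by rewrite mulr0.
- apply/is_derive1_is_diff.
  have dg' : is_diff (a * 0) (c \o gam) ( *:%R^~ v) by rewrite mulr0.
  refine (is_diff_eq (is_diff_comp Da dg') _).
  by apply/funext => t /=; rewrite scalerA mulrC.
Qed.

Lemma differentiable_hom_exists v : exists gam, differentiable_hom v gam.
Proof.
have [d d0 small] := differentiable_hom_small.
have v1 : 0 < 2 * (`|v| + 1) :> R by rewrite mulr_gt0 // ltr_wpDl.
(* Then 2 |a v| = d |v| / (|v| + 1) < d; the summand 1 also covers v = 0. *)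
pose a := d / (2 * (`|v| + 1)); have a0 : 0 < a by rewrite divr_gt0.
have [|gam gamP] := small (a *: v).
  rewrite normrZ gtr0_norm // /a mulrCA -mulrA gtr_pMr // mulrC.
  rewrite ltr_pdivrMr // mul1r; lra.
exists (fun t => gam (a^-1 * t)).
by have := differentiable_hom_scale a^-1 gamP; rewrite scalerK // gt_eqF.
Qed.

Lemma differentiable_hom_continuous v gam : differentiable_hom v gam -> continuous gam.
Proof.
move=> [gamD cg _] t.
have gE : gam = (fun s => gam t * gam (s - t))%g.
  by apply/funext => s; rewrite -gamD addrC subrK.
change (gam @ t --> gam t); rewrite -[X in _ --> X]mulg1 -(hom_zero gamD) [X in X @ _]gE.
apply: cvg_lie_mul; first exact: cvg_cst.
have ct : s - t @[s --> t] --> (0 : R).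
  by rewrite -(subrr t); apply: cvgB; [exact: cvg_id|exact: cvg_cst].
exact: cvg_comp ct cg.
Qed.

(** The identity gam(s) = gam(t) gam(s - t) moves the question to time 0. *)
Lemma differentiable_hom_derive (W : normedModType R) (f : G -> W) v gam (t : R) :
  differentiable_hom v gam ->
  differentiable (fun y => f (gam t * chart_inv c y)%g) e ->
  is_derive t 1 (f \o gam) ('d (fun y => f (gam t * chart_inv c y)%g) e v).
Proof.
move=> [gamD cg dg] df.
have := @is_derive_along_curve _ _ _ _ hc _ (fun g => f (gam t * g)%g) gam 0 v
  (hom_zero gamD) cg dg df.
move=> /is_derive1_is_diff D; apply/is_derive1_is_diff.
have Ds : is_diff t (fun s => s - t) id.
  refine (is_diff_eq (is_diffB (is_diff_id t) (is_diff_cst t t)) _).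
  by apply/funext => h; rewrite !fctE subr0.
have {}D : is_diff (t - t) ((fun g => f (gam t * g)%g) \o gam)
    ( *:%R^~ ('d (fun y => f (gam t * chart_inv c y)%g) e v)) by rewrite subrr.
have := is_diff_comp Ds D.
have -> : ((fun g => f (gam t * g)%g) \o gam) \o (fun s => s - t) = f \o gam.
  by apply/funext => s; rewrite /= -gamD addrC subrK.
exact.
Qed.

End OneParameterSubgroups.

(** * The exponential map *)

Section Exponential.
Context {R : realType} {r : nat} {G : lieGroupType R r}.
Variable c : chart G 'rV[R]_r.
Hypothesis hc : is_unit_chart c.
Local Notation e := (c 1%g).
Implicit Types (v : 'rV[R]_r) (gam : R -> G).

Let Ac : lie_atlas G c := proj1 hc.
Let dc1 : chart_dom c 1%g := proj2 hc.

(** Written as a partial derivative of the product in its second factor, so that smoothness in the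
    base point is inherited from the multiplication. *)
Definition left_invariant_field (d : chart G 'rV[R]_r) v (x : 'rV[R]_r) : 'rV[R]_r :=
  'd (mul_chart d c d) (x, e) (0, v).

Lemma mul_chart_dom_unit (d : chart G 'rV[R]_r) x : lie_atlas G d ->
  chart_cod d x -> mul_chart_dom d c d (x, e).
Proof.
move=> Ad dx; split; first by split => //; exact: unit_chart_cod.
by rewrite /= (unit_chart_inv hc) mulg1; exact: lie_chart_inv_dom.
Qed.

Lemma left_invariant_field_smooth (d : chart G 'rV[R]_r) v : lie_atlas G d ->
  smooth_on (chart_cod d) (left_invariant_field d v).
Proof.
move=> Ad k; have [_ /(_ (0, v)) sm] := mul_chart_smooth Ad Ac Ad k.+1.
have D (x : 'rV[R]_r) : is_diff x (fun x => (x, e)) (fun u => (u, 0)).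
  by apply: is_diff_pair; exact: is_diff_cst.
apply: (C_on_affine (lie_chart_cod_open Ad) D _ sm) => x dx.
exact: mul_chart_dom_unit.
Qed.

Lemma is_diff_left_translate (d : chart G 'rV[R]_r) g : lie_atlas G d ->
  chart_dom d g -> differentiable (fun y => d (g * chart_inv c y)%g) e /\
  forall v, 'd (fun y => d (g * chart_inv c y)%g) e v =
    left_invariant_field d v (d g).
Proof.
move=> Ad dg.
have We := mul_chart_dom_unit Ad (lie_chart_cod dg).
have D : is_diff e (fun y => (d g, y)) (fun u => (0, u)).
  by apply: is_diff_pair; exact: is_diff_cst.
have [D1 D2] := @is_diff_comp _ _ _ _ _ _ _ _ e D
  (differentiableP (differentiable_mul_chart Ad Ac Ad We)).
have E : (fun y => d (g * chart_inv c y)%g) =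
    mul_chart d c d \o (fun y => (d g, y)).
  by apply/funext => y; rewrite /= /mul_chart /= lie_chartK.
by rewrite E; split => // v; rewrite D2.
Qed.

(** In a chart, gam' = X(gam) with X smooth. If gam is C^k then so is X(gam), hence gam is
    C^(k+1). *)
Lemma differentiable_hom_one_param v gam :
  differentiable_hom c v gam -> one_param_subgroup c v gam.
Proof.
move=> gamP; have [gamD cg dg] := gamP; split => //.
have cgam := differentiable_hom_continuous gamP.
split; first by move=> t _; exact: cgam.
move=> c' d -> Ad k; pose O := gam @^-1` chart_dom d.
have oO : open O by apply: open_comp => //; exact: lie_chart_dom_open.
apply: (@C_on_sub _ _ _ _ O); first by move=> _ [t [_ dt] <-].
change (C_on k O (d \o gam)).
have Dt t : O t -> is_diff t (d \o gam)
    ( *:%R^~ (left_invariant_field d v (d (gam t)))).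
  move=> Ot; have [D1 D2] := is_diff_left_translate Ad Ot.
  apply/is_derive1_is_diff; rewrite -D2.
  exact: (differentiable_hom_derive hc gamP D1).
elim: k => [|k IH].
  by move=> t Ot; apply: differentiable_continuous; have [] := Dt t Ot.
split=> [t /Dt[]//|s].
have cX : C_on k O (left_invariant_field d v \o (d \o gam)).
  apply: (C_on_comp (has_frame_rV r) oO _ IH (left_invariant_field_smooth v Ad k)).
  by move=> t Ot; exact: lie_chart_cod.
have sc : continuous ( *:%R s : 'rV[R]_r -> 'rV[R]_r) by exact: scaler_continuous.
apply: C_on_eq (C_on_linear oO sc cX) => // t Ot.
by have [_ ->] := Dt t Ot.
Qed.

Lemma one_param_differentiable_hom v gam :
  one_param_subgroup c v gam -> differentiable_hom c v gam.
Proof. by move=> [gD [cg _] dg]; split => //; exact: cg. Qed.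

(** The differential of the product at the unit is addition, and the two factors have velocities v
    and -v. *)
Lemma differentiable_hom_quotient v gam1 gam2 :
  differentiable_hom c v gam1 -> differentiable_hom c v gam2 ->
  is_derive (0 : R) 1 (c \o (fun s => gam1 s * gam2 (- s))%g) 0.
Proof.
move=> [g1D cg1 /is_derive1_is_diff dg1] P2.
have g20 : gam2 0 = 1%g by have [/hom_zero] := P2.
have := differentiable_hom_scale (-1) P2.
rewrite scaleN1r => -[_ cg2 /is_derive1_is_diff dg2].
have mE t : -1 * t = - t by rewrite mulN1r.
have g2E : (fun t => gam2 (-1 * t)) = (fun t => gam2 (- t)).
  by apply/funext => t; rewrite mE.
rewrite g2E in cg2 dg2.
apply/is_derive1_is_diff.
have Dm : is_diff ((c \o gam1) 0, (c \o (fun t => gam2 (- t))) 0)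
    (mul_chart c c c) (fun u => u.1 + u.2).
  rewrite /= oppr0 (hom_zero g1D) g20.
  exact: is_diff_mul_unit.
have D := is_diff_comp (is_diff_pair dg1 dg2) Dm.
have {}D : is_diff (0 : R) (mul_chart c c c \o
    (fun y => ((c \o gam1) y, (c \o (fun t => gam2 (- t))) y))) ( *:%R^~ 0).
  refine (is_diff_eq D _); apply/funext => t /=.
  by rewrite scalerN subrr scaler0.
apply: near_eq_is_diff D.
have n1 : \forall s \near (0 : R), chart_dom c (gam1 s).
  apply: cg1; rewrite (hom_zero g1D); apply: open_nbhs_nbhs; split => //.
  exact: lie_chart_dom_open.
have n2 : \forall s \near (0 : R), chart_dom c (gam2 (- s)).
  apply: cg2; rewrite oppr0 g20; apply: open_nbhs_nbhs; split => //.
  exact: lie_chart_dom_open.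
by near=> s; rewrite /mul_chart /= !lie_chartK //; near: s.
Unshelve. all: by end_near. Qed.

(* By the previous lemma and translation, [gam1 t * gam2 (- t)] has derivative
   [0] wherever it stays in the chart. *)
Lemma differentiable_hom_unique v gam1 gam2 :
  differentiable_hom c v gam1 -> differentiable_hom c v gam2 -> gam1 = gam2.
Proof.
move=> P1 P2; have [g1D cg1 dg1] := P1; have [g2D cg2 dg2] := P2.
pose q t := (gam1 t * gam2 (- t))%g.
have cq : continuous q.
  move=> t; apply: cvg_lie_mul; first exact: (differentiable_hom_continuous P1).
  have cN : - s @[s --> t] --> - t by apply: cvgN; exact: cvg_id.
  exact: cvg_comp cN (differentiable_hom_continuous P2 (x := - t)).
have q0 : q 0 = 1%g by rewrite /q oppr0 (hom_zero g1D) (hom_zero g2D) mulg1.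
have dq t : chart_dom c (q t) -> is_diff t (c \o q) (fun _ => 0).
  move=> qt.
  (* Since q(s) = gam1(t) q(s - t) gam2(-t), the derivative of q at t is the image of its derivative
     at 0 under a translation. *)
  have df := differentiable_translate hc Ac qt.
  have := @is_derive_along_curve _ _ _ _ hc _
    (fun g => c (gam1 t * g * gam2 (- t))%g) q 0 0 q0 (cq 0)
    (differentiable_hom_quotient P1 P2) df.
  rewrite linear0 => /is_derive1_is_diff D.
  have Ds : is_diff t (fun s => s - t) id.
    refine (is_diff_eq (is_diffB (is_diff_id t) (is_diff_cst t t)) _).
    by apply/funext => h; rewrite !fctE subr0.
  have {}D : is_diff (t - t) ((fun g => c (gam1 t * g * gam2 (- t))%g) \o q)
      ( *:%R^~ 0) by rewrite subrr.
  have D' := is_diff_comp Ds D.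
  have E : c \o q = ((fun g => c (gam1 t * g * gam2 (- t))%g) \o q) \o (fun s => s - t).
    apply/funext => s; rewrite /= /q !mulgA -g1D [t + _]addrC subrK -!mulgA -g2D.
    by rewrite opprB addrAC subrr add0r.
  by rewrite E; refine (is_diff_eq D' _); apply/funext => h /=; rewrite scaler0.
have nq : \forall t \near (0 : R), chart_dom c (q t).
  apply: cq; rewrite q0; apply: open_nbhs_nbhs; split => //.
  exact: lie_chart_dom_open.
have /nbhs_ballP[eps /= eps0 epsP] := nq.
have epsQ t : `|t| < eps -> chart_dom c (q t).
  by move=> te; apply: epsP; rewrite -ball_normE /= sub0r normrN.
have q1 t : `|t| < eps -> q t = 1%g.
  move=> te; suff E : c (q t) = e by rewrite -(lie_chartK Ac (epsQ t te)) E lie_chartK.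
  apply/rowP => i.
  (* The mean value theorem is for scalar functions, so constancy is proved coordinate by
     coordinate. *)
  have D s : 0 <= s <= 1 -> is_diff (0 + s *: t) (fun s => c (q s) 0 i) (fun _ => 0).
    move=> /andP[s0 s1].
    have qs : chart_dom c (q (0 + s *: t)).
      apply: epsQ; rewrite add0r normrZ ger0_norm //; apply: le_lt_trans te.
      by rewrite ler_piMl.
    have Di := differentiableP (differentiable_coord (c (q (0 + s *: t))) 0 i).
    refine (is_diff_eq (is_diff_comp (dq _ qs) Di) _).
    by apply/funext => h /=; rewrite linear0.
  have [s s01] := @mean_value_segment _ _ (fun s => c (q s) 0 i) 0 t
    (fun s s01 => @ex_diff _ _ _ _ _ _ _ (D s s01)).
  rewrite (@diff_val _ _ _ _ _ _ _ (D s s01)) add0r q0 => /eqP.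
  by rewrite subr_eq0 => /eqP.
have small t : `|t| < eps -> gam1 t = gam2 t.
  by move=> /q1; rewrite /q hom_opp // => /divg1_eq.
apply/funext => t.
(* This [n] exceeds |t| / eps, so the curves agree at t / n, and their n-th powers agree at t. *)
pose n := (Num.trunc (`|t| / eps)).+1.
have n0 : 0 < n%:R :> R by rewrite ltr0n.
have -> : t = n%:R * (t / n%:R) by rewrite mulrCA mulfV ?mulr1 // gt_eqF.
rewrite !hom_mulrn // small // normrM normfV (gtr0_norm n0) ltr_pdivrMr //.
by rewrite -ltr_pdivrMl // mulrC; exact: truncnS_gt.
Unshelve. all: by end_near. Qed.

(** Whichever subgroup [lie_exp] selects for the velocity t v, uniqueness makes it s |-> gam(t s),
    whose value at 1 is gam(t). The same curve shows that there is one to select. *)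
Lemma lie_exp_curve v gam (t : R) :
  differentiable_hom c v gam -> lie_exp c (t *: v) = gam t.
Proof.
move=> P; rewrite /lie_exp; case: xgetP => [g -> [gam' P' <-]|].
  have := differentiable_hom_scale t P => P1.
  rewrite (differentiable_hom_unique (one_param_differentiable_hom P') P1).
  by rewrite mulr1.
move=> /(_ (gam t)) []; exists (fun s => gam (t * s)); last by rewrite mulr1.
exact/differentiable_hom_one_param/differentiable_hom_scale.
Qed.

(** This is how [lie_exp] is eliminated from [lie_bracket] and from [Phi]. *)
Lemma is_derive_lie_exp (W : normedModType R) (f : G -> W) v :
  differentiable (f \o chart_inv c) e ->
  is_derive (0 : R) 1 (fun t => f (lie_exp c (t *: v))) ('d (f \o chart_inv c) e v).
Proof.
move=> df; have [gam P] := differentiable_hom_exists hc v.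
have -> : (fun t => f (lie_exp c (t *: v))) = f \o gam.
  by apply/funext => t; rewrite /= (lie_exp_curve t P).
have [gD cg dg] := P.
exact: (is_derive_along_curve hc (hom_zero gD) cg dg df).
Qed.

End Exponential.

(** * The adjoint representation *)

Section AdjointRepresentation.
Context {R : realType} {r : nat} {G : lieGroupType R r}.
Variable c : chart G 'rV[R]_r.
Hypothesis hc : is_unit_chart c.
Local Notation e := (c 1%g).
Implicit Types (v w : 'rV[R]_r) (g h : G).

Let Ac : lie_atlas G c := proj1 hc.
Let dc1 : chart_dom c 1%g := proj2 hc.

Lemma differentiable_conj g :
  differentiable (fun y => c (g * chart_inv c y * g^-1)%g) e.
Proof. by apply: differentiable_translate => //; rewrite mulgV. Qed.

(** This chain rule serves three times: f is a conjugation for the multiplicativity of [Ad], [Ad]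
    itself for the invariance of the bracket, and the orbit map for the equivariance of the
    infinitesimal action. *)
Lemma is_diff_conj (W : normedModType R) (f : G -> W) g :
  differentiable (f \o chart_inv c) e ->
  is_diff e (fun y => f (g * chart_inv c y * g^-1)%g)
    ('d (f \o chart_inv c) e \o Ad c g).
Proof.
move=> df.
have D1 := differentiableP (differentiable_conj g).
have D2 : is_diff (c (g * chart_inv c e * g^-1)%g) (f \o chart_inv c)
    ('d (f \o chart_inv c) e).
  by rewrite (unit_chart_inv hc) mulg1 mulgV; exact: differentiableP.
apply: near_eq_is_diff (is_diff_comp D1 D2).
have := @near_unit_translate _ _ _ _ hc c g g^-1%g Ac; rewrite mulgV => /(_ dc1).
by apply: filterS => y dy; rewrite /= lie_chartK.
Qed.

Lemma Ad_linear g : linear (Ad c g).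
Proof. by move=> a u v; exact: linearP. Qed.

Lemma Ad_continuous g : continuous (Ad c g).
Proof. exact: diff_continuous (differentiable_conj g). Qed.

Lemma Ad_mul g h w : Ad c (g * h)%g w = Ad c g (Ad c h w).
Proof.
have := is_diff_conj h (f := fun q => c (g * q * g^-1)%g) (differentiable_conj g).
have <- : (fun x => c (g * h * chart_inv c x * (g * h)^-1)%g) =
    (fun y => c (g * (h * chart_inv c y * h^-1) * g^-1)%g).
  by apply/funext => y; rewrite invgM !mulgA.
by move=> [_ E]; exact: (congr1 (@^~ w) E).
Qed.

(** Conjugation of [p.2] by [p.1], with the intermediate product and the inverse also read in the
    chart. It is thus a composite of maps known to be smooth, and it is the true conjugation only
    where these intermediate elements stay in the chart. *)
Definition conj_chart (p : 'rV[R]_r * 'rV[R]_r) : 'rV[R]_r :=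
  mul_chart c c c (mul_chart c c c p, inv_chart c c p.1).

Lemma conj_chart_smooth : exists U : set ('rV[R]_r * 'rV[R]_r),
  [/\ open U, U (e, e), smooth_on U conj_chart & forall p, U p ->
   conj_chart p = c (chart_inv c p.1 * chart_inv c p.2 * (chart_inv c p.1)^-1)%g].
Proof.
pose W := mul_chart_dom c c c; pose V := inv_chart_dom c c.
have oW : open W by exact: mul_chart_dom_open.
have oV : open V by exact: inv_chart_dom_open.
pose U1 := W `&` fst @^-1` V.
have oU1 : open U1.
  apply: (open_setI_preimage (f := fst) oW _ oV) => p _.
  exact: cvg_fst.
pose h (p : 'rV[R]_r * 'rV[R]_r) := (mul_chart c c c p, inv_chart c c p.1).
have Ch k : C_on k U1 h.
  apply: C_on_pair => //.
    by apply: C_on_sub (mul_chart_smooth Ac Ac Ac k) => p [].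
  apply: (C_on_affine oU1 is_diff_fst _ (inv_chart_smooth Ac Ac k)).
  by move=> p [].
pose U := U1 `&` h @^-1` W.
have oU : open U.
  apply: (open_setI_preimage (f := h) oU1 _ oW) => p U1p.
  exact: C_on_continuous (Ch 0%N) U1p.
exists U; split => //.
- have i1 : chart_inv c e = 1%g by exact: unit_chart_inv.
  have ec : chart_cod c e by exact: unit_chart_cod.
  have me : mul_chart c c c (e, e) = e by rewrite /mul_chart /= i1 mulg1.
  have ie : inv_chart c c e = e by rewrite /inv_chart i1 invg1.
  split; first split.
  + by split; [split|rewrite /= i1 mulg1].
  + by split; rewrite //= i1 invg1.
  + rewrite /= /h me /= ie.
    by split; [split|rewrite /= i1 mulg1].
- move=> k; apply: (C_on_comp (f := h) _ oU _ _ (mul_chart_smooth Ac Ac Ac k)).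
  + exact: has_frame_pair (has_frame_rV r) (has_frame_rV r).
  + by move=> p [].
  + by apply: C_on_sub (Ch k) => p [].
- move=> p [[Wp [_ Vp]] _]; rewrite /conj_chart /mul_chart /inv_chart /=.
  by rewrite !lie_chartK //; have [] := Wp.
Qed.

(** For y near [e], Ad(y) w is the derivative of [conj_chart] at (y, e) along (0, w). As
    [conj_chart] is C^2, this can be differentiated once more in y. *)
Lemma differentiable_Ad w : differentiable (fun y => Ad c (chart_inv c y) w) e.
Proof.
have [U [oU Ue sm KE]] := conj_chart_smooth.
have [dK /(_ (0, w)) [d2 _]] := sm 2%N.
have De (y : 'rV[R]_r) : is_diff y (fun y => (y, e)) (fun u => (u, 0)).
  by apply: is_diff_pair; exact: is_diff_cst.
have D : differentiable (fun y => 'd conj_chart (y, e) (0, w)) e.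
  apply: (@differentiable_comp _ _ _ _ (fun y => (y, e))
    (fun z => 'd conj_chart z (0, w))); last exact: d2.
  by have [] := De e.
apply: near_eq_differentiable D.
have nU : \forall y \near e, U (y, e).
  have [/differentiable_continuous ce _] := De e.
  by apply: ce; apply: open_nbhs_nbhs; split.
apply: filterS nU => y Uy.
have Dy : is_diff e (fun x : 'rV[R]_r => (y, x)) (fun u => (0, u)).
  by apply: is_diff_pair; exact: is_diff_cst.
have D2 := @is_diff_comp _ _ _ _ _ _ conj_chart _ e Dy (differentiableP (dK _ Uy)).
have nUx : \forall x \near e, U (y, x).
  have [/differentiable_continuous ce _] := Dy.
  by apply: ce; apply: open_nbhs_nbhs; split.
have [_ E] : is_diff e (fun x => c (chart_inv c y * chart_inv c x * (chart_inv c y)^-1)%g)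
    ('d conj_chart (y, e) \o (fun u => (0, u))).
  by apply: near_eq_is_diff D2; apply: filterS nUx => x Ux; rewrite /= KE.
by rewrite /Ad E.
Qed.

Lemma lie_bracketE v w :
  lie_bracket c v w = 'd (fun y => Ad c (chart_inv c y) w) e v.
Proof.
rewrite /lie_bracket derive1E.
have [_ ->] := @is_derive_lie_exp _ _ _ _ hc _ (fun g => Ad c g w) v
  (differentiable_Ad w).
by [].
Qed.

Lemma lie_bracket_suml (n : nat) (a : 'I_n -> R) (x : 'I_n -> 'rV[R]_r) w :
  lie_bracket c (\sum_i a i *: x i) w = \sum_i a i *: lie_bracket c (x i) w.
Proof.
rewrite lie_bracketE linear_sum; apply: eq_bigr => i _.
by rewrite linearZ -lie_bracketE.
Qed.

Lemma lie_bracket_sumr (n : nat) (a : 'I_n -> R) (x : 'I_n -> 'rV[R]_r) v :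
  lie_bracket c v (\sum_i a i *: x i) = \sum_i a i *: lie_bracket c v (x i).
Proof.
have lin : linear (lie_bracket c v).
  move=> b w w'.
  have Dw := differentiableP (differentiable_Ad w).
  have Dw' := differentiableP (differentiable_Ad w').
  have [_ E] := is_diffD (is_diffZ b Dw) Dw'.
  rewrite !lie_bracketE.
  have -> : (fun y => Ad c (chart_inv c y) (b *: w + w')) =
      b *: (fun y => Ad c (chart_inv c y) w) + (fun y => Ad c (chart_inv c y) w').
    by apply/funext => y; rewrite Ad_linear !fctE.
  exact: (congr1 (@^~ v) E).
pose lM := GRing.isLinear.Build _ _ _ _ _ lin.
pose l : {linear 'rV[R]_r -> 'rV[R]_r} := HB.pack (lie_bracket c v) lM.
rewrite -[LHS]/(l _) linear_sum; apply: eq_bigr => i _.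
by rewrite linearZ.
Qed.

Lemma Ad_lie_bracket g v w :
  Ad c g (lie_bracket c v w) = lie_bracket c (Ad c g v) (Ad c g w).
Proof.
rewrite !lie_bracketE.
have [_ E1] := is_diff_conj g (f := fun q => Ad c q (Ad c g w))
  (differentiable_Ad (Ad c g w)).
have Dg : is_diff ((fun y => Ad c (chart_inv c y) w) e) (Ad c g) (Ad c g).
  apply: DiffDef; first exact/linear_differentiable/Ad_continuous.
  by rewrite diff_lin //; exact: Ad_continuous.
have := is_diff_comp (differentiableP (differentiable_Ad w)) Dg.
have -> : Ad c g \o (fun y => Ad c (chart_inv c y) w) =
    (fun y => Ad c (g * chart_inv c y * g^-1)%g (Ad c g w)).
  by apply/funext => y; rewrite /= -!Ad_mul mulgVK.
move=> [_ E2].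
exact: (etrans (esym (congr1 (@^~ v) E2)) (congr1 (@^~ v) E1)).
Qed.

End AdjointRepresentation.

(** * Infinitesimal action and Poisson bracket *)

Lemma is_diff_coord {R : realType} n (x : 'rV[R]_n) (i : 'I_n) :
  is_diff x (fun y : 'rV[R]_n => y 0 i : R) (fun y => y 0 i).
Proof.
have lin : linear (fun y : 'rV[R]_n => y 0 i : R).
  by move=> a u w; rewrite !mxE.
pose lM := GRing.isLinear.Build _ _ _ _ _ lin.
pose l : {linear 'rV[R]_n -> R} := HB.pack (fun y : 'rV[R]_n => y 0 i : R) lM.
apply: DiffDef; first exact: differentiable_coord.
by apply: (@diff_lin _ _ _ l); exact: coord_continuous.
Qed.

Lemma is_diff_mulmxr {R : realType} m n (B : 'M[R]_(m, n)) (x : 'rV[R]_m) :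
  is_diff x (mulmxr B) (mulmxr B).
Proof.
have D (y : 'rV[R]_m) : differentiable (mulmxr B) y.
  have -> : mulmxr B = \sum_(i < m) (fun w : 'rV[R]_m => w 0 i *: row i B) :> (_ -> _).
    apply/funext => w; rewrite fct_sumE /=; exact: mulmx_sum_row.
  by apply: differentiable_sum => i; apply: differentiableZl; exact: differentiable_coord.
apply: DiffDef; first exact: D.
by apply: diff_lin => y; exact/differentiable_continuous/D.
Qed.

Section InfinitesimalAction.
Context {R : realType} {r p : nat} {G : lieGroupType R r}.
Variable c : chart G 'rV[R]_r.
Hypothesis hc : is_unit_chart c.
Local Notation e := (c 1%g).
Variables (M : set 'rV[R]_p) (act : G -> 'rV[R]_p -> 'rV[R]_p).
Hypothesis hact : is_smooth_left_action M act.
Implicit Types (z : 'rV[R]_p) (g h : G).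

Let Ac : lie_atlas G c := proj1 hc.
Let dc1 : chart_dom c 1%g := proj2 hc.

Let act_mul h g z : M z -> act h (act g z) = act (h * g)%g z.
Proof. by have [_ _ H _] := hact; exact: H. Qed.

Lemma differentiable_act_chart (d : chart G 'rV[R]_r) g z :
  lie_atlas G d -> chart_dom d g -> M z ->
  differentiable (fun x : 'rV[R]_r * 'rV[R]_p => act (chart_inv d x.1) x.2) (d g, z).
Proof.
move=> Ad dg Mz; have [_ _ _ [_ sm]] := hact.
have A1 : prod_atlas (lie_atlas G) (std_atlas 'rV[R]_p)
    (prod_chart d (Chart [set: 'rV[R]_p] id id)).
  by exists d => //; exists (Chart [set: 'rV[R]_p] id id).
have A2 : std_atlas 'rV[R]_p (Chart [set: 'rV[R]_p] id id) by [].
have [H _] := sm _ _ A1 A2 1%N.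
by apply: H; exists (g, z).
Qed.

Lemma differentiable_act_group z : M z ->
  differentiable (fun y => act (chart_inv c y) z) e.
Proof.
move=> Mz.
apply: (@differentiable_comp _ _ _ _ (fun y => (y, z))
  (fun x : 'rV[R]_r * 'rV[R]_p => act (chart_inv c x.1) x.2)).
  by apply: differentiable_pair.
exact: differentiable_act_chart.
Qed.

Lemma differentiable_act g z : M z -> differentiable (act g) z.
Proof.
move=> Mz; have [d Ad dg] := lie_chart_at g.
have -> : act g = (fun x : 'rV[R]_r * 'rV[R]_p => act (chart_inv d x.1) x.2) \o
    (fun z => (d g, z)).
  by apply/funext => z' /=; rewrite lie_chartK.
apply: differentiable_comp; first by apply: differentiable_pair.
exact: differentiable_act_chart.
Qed.

(** The infinitesimal generator in a form free of exp, hence linear in [w] by construction; [PhiE]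
    recovers the columns of [Phi] from it. *)
Definition infinitesimal_action z (w : 'rV[R]_r) : 'rV[R]_p :=
  'd (fun y => act (chart_inv c y) z) e w.

Lemma infinitesimal_action_equivariant g z w : M z ->
  infinitesimal_action (act g^-1%g z) w =
  'd (act g^-1%g) z (infinitesimal_action z (Ad c g w)).
Proof.
move=> Mz.
have D1 := is_diff_conj hc g (f := fun q => act q z) (differentiable_act_group Mz).
have D2 : is_diff ((fun y => act (g * chart_inv c y * g^-1)%g z) e) (act g^-1%g)
    ('d (act g^-1%g) z).
  rewrite (unit_chart_inv hc) mulg1 mulgV.
  have [_ -> // _ _] := hact.
  exact/differentiableP/differentiable_act.
have := is_diff_comp D1 D2.
have -> : act g^-1%g \o (fun y => act (g * chart_inv c y * g^-1)%g z) =
    (fun y => act (chart_inv c y) (act g^-1%g z)).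
  by apply/funext => y; rewrite /= !act_mul // !mulgA mulVg mul1g.
by move=> [_ E]; exact: (congr1 (@^~ w) E).
Qed.

Lemma PhiE (b : r.-tuple 'rV[R]_r) z (l : 'I_p) (k : 'I_r) : M z ->
  Phi c b act z l k = infinitesimal_action z b`_k 0 l.
Proof.
move=> Mz; rewrite mxE derive1E.
have [D1 D2] := is_diff_comp (differentiableP (differentiable_act_group Mz))
  (is_diff_coord (act (chart_inv c e) z) l).
have [_ E] := @is_derive_lie_exp _ _ _ _ hc _ (fun q => act q z 0 l) b`_k D1.
exact: (etrans E (congr1 (@^~ b`_k) D2)).
Qed.

End InfinitesimalAction.

(** * The adjoint representation and the bracket in a basis *)

Section MatricesInABasis.
Context {R : realType} {r p : nat} {G : lieGroupType R r}.
Variable c : chart G 'rV[R]_r.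
Hypothesis hc : is_unit_chart c.
Variable b : r.-tuple 'rV[R]_r.
Hypothesis hb : basis_of {:'rV[R]_r} b.

Lemma Ad_basis g (j : 'I_r) : Ad c g b`_j = \sum_i Ad_mx c b g i j *: b`_i.
Proof.
rewrite {1}(coord_basis hb (memvf (Ad c g b`_j))).
by apply: eq_bigr => i _; rewrite mxE.
Qed.

Lemma Ad_sum g (a : 'I_r -> R) (x : 'I_r -> 'rV[R]_r) :
  Ad c g (\sum_i a i *: x i) = \sum_i a i *: Ad c g (x i).
Proof.
by rewrite /Ad linear_sum; apply: eq_bigr => i _; rewrite linearZ.
Qed.

Lemma coord_Ad g (m : 'I_r) x :
  coord b m (Ad c g x) = \sum_k coord b k x * Ad_mx c b g m k.
Proof.
rewrite {1}(coord_basis hb (memvf x)) Ad_sum linear_sum.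
by apply: eq_bigr => k _; rewrite linearZ /= mxE.
Qed.

Lemma coord_lie_bracket_Ad g (i j m : 'I_r) :
  coord b m (lie_bracket c (Ad c g b`_i) (Ad c g b`_j)) =
  \sum_k \sum_l Ad_mx c b g k i * Ad_mx c b g l j * struct_const c b k l m.
Proof.
rewrite !Ad_basis (lie_bracket_suml hc) linear_sum; apply: eq_bigr => k _.
rewrite (lie_bracket_sumr hc) linearZ /= linear_sum mulr_sumr.
by apply: eq_bigr => l _; rewrite linearZ /= mulrA.
Qed.

(** Entry (i, j) on the left pairs [xi] with Ad(g)[b_i, b_j]. Replacing this by
    [Ad(g) b_i, Ad(g) b_j] and expanding bilinearly in the basis gives the right side. *)
Lemma Lambda_Ad g (xi : 'rV[R]_r) : Lambda c b (xi *m Ad_mx c b g) =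
  (Ad_mx c b g)^T *m Lambda c b xi *m Ad_mx c b g.
Proof.
apply/matrixP => i j; set B := Ad_mx c b g.
have -> : Lambda c b (xi *m B) i j =
    \sum_m xi 0 m * coord b m (Ad c g (lie_bracket c b`_i b`_j)).
  rewrite mxE; under eq_bigr do rewrite mxE mulr_sumr.
  rewrite exchange_big; apply: eq_bigr => m _ /=.
  rewrite coord_Ad mulr_sumr; apply: eq_bigr => k _.
  by rewrite /struct_const -/B mulrCA.
under eq_bigr => m _ do rewrite (Ad_lie_bracket hc) coord_lie_bracket_Ad mulr_sumr.
rewrite mxE exchange_big /=.
under [RHS]eq_bigr => l _ do rewrite mxE mulr_suml.
rewrite [RHS]exchange_big /=; apply: eq_bigr => k _.
under eq_bigr => m _ do rewrite mulr_sumr.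
rewrite exchange_big /=; apply: eq_bigr => l _.
rewrite !mxE mulr_sumr mulr_suml; apply: eq_bigr => m _.
by rewrite -/B; ring.
Qed.

End MatricesInABasis.

Section Poisson.
Context {R : realType} {r p : nat} {G : lieGroupType R r}.
Variable c : chart G 'rV[R]_r.
Hypothesis hc : is_unit_chart c.
Variable b : r.-tuple 'rV[R]_r.
Hypothesis hb : basis_of {:'rV[R]_r} b.
Variables (M : set 'rV[R]_p) (act : G -> 'rV[R]_p -> 'rV[R]_p).
Hypothesis hact : is_smooth_left_action M act.

Lemma infinitesimal_action_sum z (a : 'I_r -> R) (x : 'I_r -> 'rV[R]_r) :
  infinitesimal_action c act z (\sum_i a i *: x i) =
  \sum_i a i *: infinitesimal_action c act z (x i).
Proof.
by rewrite /infinitesimal_action linear_sum; apply: eq_bigr => i _; rewrite linearZ.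
Qed.

(** Points are rows, but the matrix is the usual Jacobian acting on columns; this fits [Phi], whose
    columns are tangent vectors. *)
Definition jacobian_act (h : G) (z : 'rV[R]_p) : 'M[R]_p :=
  \matrix_(l, m) ('d (act h) z (delta_mx 0 m)) 0 l.

Lemma jacobian_actE h z (u : 'rV[R]_p) (l : 'I_p) :
  ('d (act h) z u) 0 l = \sum_m jacobian_act h z l m * u 0 m.
Proof.
rewrite {1}[u]row_sum_delta linear_sum summxE; apply: eq_bigr => m _.
by rewrite linearZ !mxE mulrC.
Qed.

Lemma Phi_equivariant g z : M z -> Phi c b act (act g^-1%g z) =
  jacobian_act g^-1%g z *m Phi c b act z *m Ad_mx c b g.
Proof.
move=> Mz; have Mgz : M (act g^-1%g z) by have [H _ _ _] := hact; exact: H.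
apply/matrixP => l j.
rewrite (PhiE hc hact) // (infinitesimal_action_equivariant hc hact) //.
rewrite jacobian_actE (Ad_basis c hb) infinitesimal_action_sum mxE.
under [RHS]eq_bigr => i _ do rewrite mxE mulr_suml.
rewrite exchange_big /=; apply: eq_bigr => m _.
rewrite summxE mulr_sumr; apply: eq_bigr => i _.
by rewrite (PhiE hc hact) // [X in _ * X = _]mxE mulrCA mulrC.
Qed.

Lemma poissonE (F H : 'rV[R]_p * 'rV[R]_r -> R) x :
  poisson c b act F H x =
  ((grad_z F x)^T *m Phi c b act x.1 *m grad_xi H x
   - (grad_xi F x)^T *m (Phi c b act x.1)^T *m grad_z H x
   + (grad_xi F x)^T *m Lambda c b x.2 *m grad_xi H x) 0 0.
Proof.
rewrite /poisson mul_row_block mul_row_col mulmx0 add0r mulmxN mulNmx mulmxDl.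
by rewrite addrA [- _ + _]addrC.
Qed.

(** Each component of [psi] depends on one of the two variables only, so the differential is block
    diagonal and the two gradients transform separately. *)
Lemma is_diff_psi g (x : 'rV[R]_p * 'rV[R]_r) : M x.1 ->
  is_diff x (psi c b act g)
    (fun u => ('d (act g^-1%g) (x.1) u.1, u.2 *m Ad_mx c b g)).
Proof.
move=> Mx.
have Dm : is_diff (x.2) (mulmxr (Ad_mx c b g)) (mulmxr (Ad_mx c b g)).
  exact: is_diff_mulmxr.
have Da : is_diff (x.1) (act g^-1%g) ('d (act g^-1%g) (x.1)).
  exact/differentiableP/(differentiable_act hact).
exact: is_diff_pair (is_diff_comp (is_diff_fst x) Da) (is_diff_comp (is_diff_snd x) Dm).
Qed.

Lemma grad_z_comp g F x : M x.1 -> differentiable F (psi c b act g x) ->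
  grad_z (F \o psi c b act g) x =
  (jacobian_act g^-1%g x.1)^T *m grad_z F (psi c b act g x).
Proof.
move=> Mx dF; have Dpsi := is_diff_psi g Mx.
have [D1 D2] := is_diff_comp Dpsi (differentiableP dF).
apply/colP => l; rewrite !mxE deriveE //.
apply: etrans (congr1 (@^~ (delta_mx 0 l, 0)) D2) _ => /=.
rewrite mul0mx.
have -> : ('d (act g^-1%g) (x.1) (delta_mx 0 l), 0) =
    \sum_m jacobian_act g^-1%g x.1 m l *: (delta_mx 0 m, 0) :> 'rV[R]_p * 'rV[R]_r.
  rewrite sum_scale_pairl; congr pair.
  rewrite [LHS]row_sum_delta; apply: eq_bigr => m _.
  by rewrite mxE.
rewrite linear_sum; apply: eq_bigr => m _.
by rewrite linearZ !mxE deriveE.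
Qed.

(** The row [xi] is multiplied on the right by the matrix, so the column gradient is multiplied on
    the left by the same matrix, without a transpose. *)
Lemma grad_xi_comp g F x : M x.1 -> differentiable F (psi c b act g x) ->
  grad_xi (F \o psi c b act g) x =
  Ad_mx c b g *m grad_xi F (psi c b act g x).
Proof.
move=> Mx dF; have Dpsi := is_diff_psi g Mx.
have [D1 D2] := is_diff_comp Dpsi (differentiableP dF).
apply/colP => k; rewrite !mxE deriveE //.
apply: etrans (congr1 (@^~ (0, delta_mx 0 k)) D2) _ => /=.
rewrite linear0 -rowE.
have -> : (0, row k (Ad_mx c b g)) =
    \sum_j Ad_mx c b g k j *: (0, delta_mx 0 j) :> 'rV[R]_p * 'rV[R]_r.
  rewrite sum_scale_pairr; congr pair.
  rewrite [LHS]row_sum_delta; apply: eq_bigr => m _.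
  by rewrite mxE.
rewrite linear_sum; apply: eq_bigr => j _.
by rewrite linearZ !mxE deriveE.
Qed.

End Poisson.

Unset Implicit Arguments.

Theorem theorem2p20 (R : realType) (r p : nat) (G : lieGroupType R r)
    (c : chart G 'rV[R]_r) (hc : is_unit_chart c)
    (v : r.-tuple 'rV[R]_r) (hv : basis_of {:'rV[R]_r} v)
    (M : set 'rV[R]_p) (hM : open M)
    (act : G -> 'rV[R]_p -> 'rV[R]_p)
    (hact : is_smooth_left_action M act) :
  is_canonical (M `*` [set: 'rV[R]_r]) (poisson c v act) (psi c v act).
Proof.
move=> g F H sF sH x [Mx _].
have Mgx : (M `*` [set: 'rV[R]_r]) (psi c v act g x).
  by split => //=; have [h _ _ _] := hact; exact: h.
have dF : differentiable F (psi c v act g x) by have [/(_ _ Mgx)] := sF 1%N.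
have dH : differentiable H (psi c v act g x) by have [/(_ _ Mgx)] := sH 1%N.
have EP : Phi c v act (psi c v act g x).1 =
    jacobian_act act g^-1%g x.1 *m Phi c v act x.1 *m Ad_mx c v g.
  exact: (Phi_equivariant hc hv hact).
have EL : Lambda c v (psi c v act g x).2 =
    (Ad_mx c v g)^T *m Lambda c v x.2 *m Ad_mx c v g.
  exact: (Lambda_Ad hc hv).
(* The factors that [EP] and [EL] put around [Phi] and [Lambda] are exactly those that the chain
   rule puts on the gradients, so both sides become the same matrix products. *)
rewrite !poissonE EP EL (grad_z_comp hact Mx dF) (grad_z_comp hact Mx dH).
rewrite (grad_xi_comp hact Mx dF) (grad_xi_comp hact Mx dH).
by rewrite !trmx_mul !trmxK !mulmxA.
Qed.
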